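(* Let $G$ be a commutative multiplicative group, let $L$ be a $G$-graded field with graded subfields $l$, $K$ and $k\subseteq l\cap K$, and let $\psi_{L/l,K/k}\colon\mathbf P_{L/l}\to\mathbf P_{K/k}$, $\mathcal O\mapsto\mathcal O\cap K$. Then: (1) $\psi_{L/l,K/k}$ is surjective if and only if $l$ and $K$ are in general position with respect to $k$; (2) $\psi_{L/l,K/k}$ has finite fibers (resp. is injective) if $L/K$ is finite (resp. $L=K$); (3) $\psi_{L/l,K/k}$ is bijective if $l/k$ is algebraic, $L_1=K_1$, and $\rho(L^\times)/\rho(K^\times)$ is a torsion group.
   Context: A graded field is a nonzero $G$-graded ring whose nonzero homogeneous elements are invertible; $F_1$ is its degree-$1$ part, $F^\times$ its group of nonzero homogeneous elements and $\rho\colon F^\times\to G$ the grading. For graded fields $k\subseteq F$, $\mathbf P_{F/k}$ is the set of graded valuation rings of $F$ containing $k$ (graded subrings $\mathcal O$ with $f\in\mathcal O$ or $f^{-1}\in\mathcal O$ for every nonzero homogeneous $f$), topologized by sets $\{\mathcal O:f_1,\dots,f_n\in\mathcal O\}$. A finite set $S\subseteq F^\times$ is algebraically independent over $k$ if the graded $k$-algebra map $k[\rho(s)^{-1}T_s]_{s\in S}\to F$, $T_s\mapsto s$, is injective; $F/k$ is finite if $F$ has finite rank as a graded $k$-module, algebraic if every element is integral over $k$; transcendence degree is the cardinality of a maximal algebraically independent set. Graded subfields $l,K$ of $L$ containing $k$ are in general position with respect to $k$ if every subset of $l^\times$ algebraically independent over $k$ is algebraically independent over $K$ (equivalently $\mathrm{trdeg}_k(l'K')=\mathrm{trdeg}_k(l')+\mathrm{trdeg}_k(K')$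 for all finitely generated graded subfields $k\subseteq l'\subseteq l$, $k\subseteq K'\subseteq K$). *)

(* Defs.v *)
From mathcomp Require Import all_boot all_order all_algebra.
From mathcomp Require Import mpoly.
Set Implicit Arguments. Unset Strict Implicit. Unset Printing Implicit Defensive.
Import GRing.Theory.
Local Open Scope ring_scope.

(* The commutative group G is written additively (G : zmodType);
   its neutral element "1" is 0 and "g h" is g + h.
   A grading of the commutative ring L is given by the family of
   homogeneous components  hom g = L_g  (as predicates on L). *)

Section Graded.
Variables (G : zmodType) (L : comUnitRingType) (hom : G -> L -> Prop).

Definition is_grading : Prop :=
  [/\ (forall g, hom g 0) /\
      (forall g x y, hom g x -> hom g y -> hom g (x - y)),
      (forall g h x y, hom g x -> hom h y -> hom (g + h) (x * y)),
      hom 0 1,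
      (forall x : L, exists (s : seq G) (f : G -> L),
          [/\ uniq s, (forall g, hom g (f g)) & x = \sum_(g <- s) f g])
    & (forall (s : seq G) (f : G -> L), uniq s -> (forall g, hom g (f g)) ->
          \sum_(g <- s) f g = 0 -> forall g, g \in s -> f g = 0)].

Definition homogeneous (x : L) : Prop := exists g, hom g x.

Definition is_graded_field : Prop :=
  [/\ is_grading, (1 : L) != 0 &
      forall x, homogeneous x -> x != 0 -> x \is a GRing.unit].

Definition graded_subring (S : L -> Prop) : Prop :=
  [/\ S 1,
      (forall x y, S x -> S y -> S (x - y)),
      (forall x y, S x -> S y -> S (x * y))
    & (forall x, S x -> exists (s : seq G) (f : G -> L),
          [/\ uniq s, (forall g, hom g (f g) /\ S (f g)) & x = \sum_(g <- s) f g])].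

Definition graded_subfield (S : L -> Prop) : Prop :=
  graded_subring S /\
  (forall x, S x -> homogeneous x -> x != 0 -> S x^-1).

Definition lsubset (A B : L -> Prop) : Prop := forall x, A x -> B x.
Definition lseteq (A B : L -> Prop) : Prop := forall x, A x <-> B x.

Definition graded_val_ring (F k O : L -> Prop) : Prop :=
  [/\ lsubset O F, graded_subring O, lsubset k O &
      forall f, F f -> homogeneous f -> f != 0 -> O f \/ O f^-1].

Definition psi (K O : L -> Prop) : L -> Prop := fun x => O x /\ K x.

Definition alg_indep (k : L -> Prop) (n : nat) (v : 'I_n -> L) : Prop :=
  forall p : {mpoly L[n]}, (forall m, k (p@_m)) -> p.@[v] = 0 -> p = 0.

Definition general_position (k l K : L -> Prop) : Prop :=
  forall (n : nat) (v : 'I_n -> L), injective v ->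
    (forall i, [/\ l (v i), homogeneous (v i) & v i != 0]) ->
    alg_indep k v -> alg_indep K v.

Definition finite_ext (K : L -> Prop) : Prop :=
  exists (n : nat) (e : 'I_n -> L),
    [/\ (forall i, homogeneous (e i)),
        (forall c : 'I_n -> L, (forall i, K (c i)) ->
            \sum_i c i * e i = 0 -> forall i, c i = 0)
      & (forall x, exists c : 'I_n -> L,
            (forall i, K (c i)) /\ x = \sum_i c i * e i)].

Definition algebraic_ext (k l : L -> Prop) : Prop :=
  forall x, l x -> exists p : {poly L},
    [/\ p \is monic, (forall i, k p`_i) & root p x].

End Graded.

(* Main.v *)
Require Import Defs.
From mathcomp Require Import all_boot all_order all_algebra.
From mathcomp Require Import mpoly ring.
From mathcomp Require Import boolp.
From mathcomp Require classical_sets.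
Set Implicit Arguments. Unset Strict Implicit. Unset Printing Implicit Defensive.
Import Order.TTheory GRing.Theory.
Local Open Scope ring_scope.

(* Chevalley's extension theorem holds in graded form: a graded subring avoiding a suitable set of
   homogeneous elements extends to a graded valuation ring of [L] avoiding it.

   If [l] and [K] are in general position and [O'] is a valuation ring of [K] over [k], one
   extends [l[O']], avoiding the homogeneous elements of [K] outside [O'].  An equation placing
   such an element in [l[O']] involves finitely many elements of [l]; these are algebraic over
   [k(T)] for a finite [T] independent over [k], hence over [K], and comparing coefficients
   shows that [O'.k(T)] avoids those elements too, so [O'] extends over [k(T)].

   Conversely, a relation over [K] between elements [v] of [l] independent over [k] is excluded
   by a valuation ring of [K] at which all residues of quotients of its coefficients are algebraic
   over [k]: extend it over [l], then refine the extension so that distinct monomials in [v] get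
   distinct values while those quotients remain units or non-units as before; two dominant terms
   of the relation would then have to agree in value.

   When [L/K] is finite, a valuation ring over [O'] is determined by its degree-0 part, and
   distinct ones are separated by degree-0 elements that are linearly independent over [K]. *)

(** * Homogeneous components and graded subrings *)

Lemma sum_uniq_sub (I : eqType) (V : nmodType) (s t : seq I) (F : I -> V) :
  uniq s -> uniq t -> {subset s <= t} -> (forall i, i \notin s -> F i = 0) ->
  \sum_(i <- s) F i = \sum_(i <- t) F i.
Proof.
move=> us ut st F0; rewrite [RHS](bigID (mem s)) /= [X in _ + X]big1 ?addr0; last first.
  by move=> i /F0.
rewrite -[RHS]big_filter; apply: perm_big; apply: uniq_perm; rewrite ?filter_uniq //.
by move=> i; rewrite mem_filter; case: (boolP (i \in s)) => //= /st ->.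
Qed.

(** [F] is total on [G] with finite support, so a decomposition is unique as a function although its
    list of degrees is not. *)
Definition comp_spec (G : zmodType) (L : comUnitRingType) (hom : G -> L -> Prop)
    (x : L) (F : G -> L) : Prop :=
  (forall g, hom g (F g)) /\
  exists s, [/\ uniq s, forall g, g \notin s -> F g = 0 & x = \sum_(g <- s) F g].

(** Over a graded field the default [0] is never taken, by [comp_spec_ex]. *)
Definition component (G : zmodType) (L : comUnitRingType) (hom : G -> L -> Prop)
    (g : G) (x : L) : L :=
  if pselect (exists F, comp_spec hom x F) is left h then projT1 (cid h) g else 0.

Section Components.
Variables (G : zmodType) (L : comUnitRingType) (hom : G -> L -> Prop).
Hypothesis hL : is_graded_field hom.
Notation comp := (component hom).

Lemma hom0 g : hom g 0. Proof. by have [[[h _] _ _ _ _] _ _] := hL. Qed.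
Lemma homB g x y : hom g x -> hom g y -> hom g (x - y).
Proof. by have [[[_ h] _ _ _ _] _ _] := hL; apply: h. Qed.
Lemma homN g x : hom g x -> hom g (- x).
Proof. by rewrite -sub0r => h; apply: homB => //; apply: hom0. Qed.
Lemma homD g x y : hom g x -> hom g y -> hom g (x + y).
Proof. by move=> hx hy; rewrite -[y]opprK; apply: homB => //; apply: homN. Qed.
Lemma homM g h x y : hom g x -> hom h y -> hom (g + h) (x * y).
Proof. by have [[_ H _ _ _] _ _] := hL; apply: H. Qed.
Lemma hom1 : hom 0 1. Proof. by have [[_ _ H _ _] _ _] := hL. Qed.
Lemma homog_unit x : homogeneous hom x -> x != 0 -> x \is a GRing.unit.
Proof. by have [_ _ H] := hL; apply: H. Qed.
Lemma homX g x n : hom g x -> hom (g *+ n) (x ^+ n).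
Proof.
move=> hx; elim: n => [|n IH]; first exact: hom1.
by rewrite exprS mulrS; apply: homM.
Qed.
Lemma hom_sum I (r : seq I) (P : pred I) g (F : I -> L) :
  (forall i, P i -> hom g (F i)) -> hom g (\sum_(i <- r | P i) F i).
Proof. by move=> H; apply: big_ind => // [|x y]; [apply: hom0|apply: homD]. Qed.
Lemma hom_prod I (r : seq I) (f : I -> G) (F : I -> L) :
  (forall i, hom (f i) (F i)) -> hom (\sum_(i <- r) f i) (\prod_(i <- r) F i).
Proof.
move=> H; elim: r => [|a r IH]; first by rewrite !big_nil; apply: hom1.
by rewrite !big_cons; apply: homM.
Qed.

Lemma comp_spec_ex x : exists F, comp_spec hom x F.
Proof.
have [[_ _ _ H _] _ _] := hL; have [s [f [us hf ->]]] := H x.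
exists (fun g => if g \in s then f g else 0); split.
  by move=> g; case: ifP => // _; apply: hom0.
exists s; split=> //; first by move=> g /negbTE ->.
by apply: eq_big_seq => g ->.
Qed.

Lemma comp_specB x y F F' : comp_spec hom x F -> comp_spec hom y F' ->
  comp_spec hom (x - y) (fun g => F g - F' g).
Proof.
move=> [hF [s [us F0 ->]]] [hF' [s' [us' F0' ->]]]; split.
  by move=> g; apply: homB.
exists (undup (s ++ s')); split; first exact: undup_uniq.
  move=> g; rewrite mem_undup mem_cat negb_or => /andP[/F0 -> /F0' ->].
  by rewrite subrr.
rewrite sumrB; congr (_ - _); apply: sum_uniq_sub; rewrite ?undup_uniq // => g gs;
  by rewrite mem_undup mem_cat gs ?orbT.
Qed.

Lemma comp_spec0 F : comp_spec hom 0 F -> forall g, F g = 0.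
Proof.
have [[_ _ _ _ H] _ _] := hL => -[hF [s [us F0 e]]] g.
case: (boolP (g \in s)) => [gs|/F0 //].
by apply: H gs => //.
Qed.

Lemma comp_specP x : comp_spec hom x (fun g => comp g x).
Proof.
rewrite /component; case: pselect => [h|]; last by case; apply: comp_spec_ex.
exact: (projT2 (cid h)).
Qed.

Lemma comp_uniq x F : comp_spec hom x F -> forall g, comp g x = F g.
Proof.
move=> h g; apply/eqP; rewrite -subr_eq0; apply/eqP.
by have := comp_specB (comp_specP x) h; rewrite subrr => /comp_spec0 ->.
Qed.

Lemma comp_hom g x : hom g (comp g x). Proof. by case: (comp_specP x). Qed.

Lemma comp_homog g x : homogeneous hom (comp g x).
Proof. by exists g; apply: comp_hom. Qed.

Lemma compB g x y : comp g (x - y) = comp g x - comp g y.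
Proof. by rewrite (comp_uniq (comp_specB (comp_specP x) (comp_specP y))). Qed.

Lemma comp0 g : comp g 0 = 0.
Proof. by have := compB g 0 0; rewrite !subrr. Qed.

Lemma compD g x y : comp g (x + y) = comp g x + comp g y.
Proof. by rewrite -{1}[y]opprK -{1}[- y]sub0r !compB comp0 sub0r opprK. Qed.

Lemma comp_sum I (r : seq I) (P : pred I) (F : I -> L) g :
  comp g (\sum_(i <- r | P i) F i) = \sum_(i <- r | P i) comp g (F i).
Proof. exact: (big_morph (comp g) (compD g) (comp0 g)). Qed.

Lemma comp_of_hom g h x : hom g x -> comp h x = if h == g then x else 0.
Proof.
move=> hx; apply: (@comp_uniq x (fun h => if h == g then x else 0)); split.
  by move=> i; case: eqP => [->|_] //; apply: hom0.
exists [:: g]; split=> //; last by rewrite big_seq1 eqxx.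
by move=> i; rewrite inE => /negbTE ->.
Qed.

Lemma comp_id g x : hom g x -> comp g x = x.
Proof. by move=> hx; rewrite (comp_of_hom _ hx) eqxx. Qed.

Lemma compMr g h x y : hom h y -> comp g (x * y) = comp (g - h) x * y.
Proof.
move=> hy; apply: (@comp_uniq _ (fun g => comp (g - h) x * y)); split.
  by move=> i; have := homM (comp_hom (i - h) x) hy; rewrite subrK.
have [_ [s [us F0 e]]] := comp_specP x.
exists (map (fun i => i + h) s); split.
- by rewrite map_inj_uniq //; apply: addIr.
- move=> i hi; rewrite F0 ?mul0r //; apply: contra hi => hi.
  by apply/mapP; exists (i - h); rewrite ?subrK.
rewrite big_map {1}e mulr_suml; apply: eq_bigr => i _.
by rewrite addrK.
Qed.

Lemma compMl g h x y : hom h y -> comp g (y * x) = y * comp (g - h) x.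
Proof. by move=> hy; rewrite mulrC (compMr _ _ hy) mulrC. Qed.

Lemma comp_decomp x : exists s : seq G, x = \sum_(g <- s) comp g x.
Proof. by have [_ [s [_ _ e]]] := comp_specP x; exists s. Qed.

Lemma comp_eq0 x : (forall g, comp g x = 0) -> x = 0.
Proof. by move=> H; have [s ->] := comp_decomp x; rewrite big1. Qed.

(** The degree-0 component of [x^-1 * x = 1] is [comp (- g) x^-1 * x], so this component is the
    inverse. *)
Lemma homV g x : hom g x -> hom (- g) x^-1.
Proof.
move=> hx; have [->|x0] := eqVneq x 0; first by rewrite invr0; apply: hom0.
have ux : x \is a GRing.unit by apply: homog_unit => //; exists g.
rewrite -[x^-1]mulr1 -[1](@comp_id 0 1 hom1) -[1](mulVr ux).
rewrite (compMr _ _ hx) sub0r mulrC -mulrA divrr // mulr1.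
exact: comp_hom.
Qed.

Lemma homogM x y : homogeneous hom x -> homogeneous hom y -> homogeneous hom (x * y).
Proof. by move=> [g hx] [h hy]; exists (g + h); apply: homM. Qed.
Lemma homogV x : homogeneous hom x -> homogeneous hom x^-1.
Proof. by move=> [g hx]; exists (- g); apply: homV. Qed.
Lemma homog_div x y : homogeneous hom x -> homogeneous hom y -> homogeneous hom (x / y).
Proof. by move=> hx hy; apply: homogM => //; apply: homogV. Qed.
Lemma homog1 : homogeneous hom 1. Proof. by exists 0; apply: hom1. Qed.
Lemma homogM_neq0 x y : homogeneous hom x -> x != 0 -> y != 0 -> x * y != 0.
Proof.
move=> hx x0; apply: contraNneq => e.
by rewrite -[y](mulKr (homog_unit hx x0)) e mulr0.
Qed.
Lemma homog_div_neq0 x y : homogeneous hom x -> x != 0 -> y != 0 -> x / y != 0.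
Proof. by move=> hx x0 y0; apply: homogM_neq0; rewrite ?invr_eq0. Qed.
Section Subring.
Variable S : L -> Prop.
Hypothesis hS : graded_subring hom S.

Lemma gsub1 : S 1. Proof. by case: hS. Qed.
Lemma gsubB x y : S x -> S y -> S (x - y). Proof. by case: hS => _ h _ _; apply: h. Qed.
Lemma gsubM x y : S x -> S y -> S (x * y). Proof. by case: hS => _ _ h _; apply: h. Qed.
Lemma gsub0 : S 0. Proof. by rewrite -(subrr 1); apply: gsubB; apply: gsub1. Qed.
Lemma gsubN x : S x -> S (- x).
Proof. by rewrite -sub0r; apply: gsubB; apply: gsub0. Qed.
Lemma gsubD x y : S x -> S y -> S (x + y).
Proof. by move=> hx hy; rewrite -[y]opprK; apply: gsubB => //; apply: gsubN. Qed.
Lemma gsubX x n : S x -> S (x ^+ n).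
Proof. by move=> hx; elim: n => [|n IH]; rewrite ?expr0 ?exprS; [apply: gsub1|apply: gsubM]. Qed.
Lemma gsub_sum I (r : seq I) (P : pred I) (F : I -> L) :
  (forall i, P i -> S (F i)) -> S (\sum_(i <- r | P i) F i).
Proof. by move=> h; apply: big_ind => //; [apply: gsub0|apply: gsubD]. Qed.
Lemma gsub_prod I (r : seq I) (P : pred I) (F : I -> L) :
  (forall i, P i -> S (F i)) -> S (\prod_(i <- r | P i) F i).
Proof. by move=> h; apply: big_ind => //; [apply: gsub1|apply: gsubM]. Qed.
Lemma gsub_comp g x : S x -> S (comp g x).
Proof.
case: hS => _ _ _ h /h [s [f [us hf e]]].
rewrite (@comp_uniq x (fun g => if g \in s then f g else 0)).
  by case: ifP => _; [case: (hf g)|apply: gsub0].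
split; first by move=> i; case: ifP => _; [case: (hf i)|apply: hom0].
exists s; split=> //; first by move=> i /negbTE ->.
by rewrite e; apply: eq_big_seq => i ->.
Qed.
Lemma gsub_horner (p : {poly L}) x : (forall i, S p`_i) -> S x -> S p.[x].
Proof.
by move=> hp hx; rewrite horner_coef; apply: gsub_sum => i _; apply: gsubM => //; apply: gsubX.
Qed.
Lemma gsub_mmon n (v : 'I_n -> L) (m : 'X_{1..n}) :
  (forall i, S (v i)) -> S (\prod_i v i ^+ m i).
Proof. by move=> h; apply: gsub_prod => i _; apply: gsubX. Qed.
Lemma gsub_meval n (v : 'I_n -> L) (p : {mpoly L[n]}) :
  (forall m, S p@_m) -> (forall i, S (v i)) -> S p.@[v].
Proof.
by move=> hp hv; rewrite mevalE; apply: gsub_sum => m _; apply: gsubM => //; apply: gsub_mmon.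
Qed.
End Subring.

Lemma gsub_intro (S : L -> Prop) : S 1 -> (forall x y, S x -> S y -> S (x - y)) ->
  (forall x y, S x -> S y -> S (x * y)) -> (forall g x, S x -> S (comp g x)) ->
  graded_subring hom S.
Proof.
move=> S1 SB SM SC; split=> // x Sx.
have [_ [s [us _ e]]] := comp_specP x.
exists s, (fun g => comp g x); split=> // g; split; first exact: comp_hom.
exact: SC.
Qed.

Lemma gsub_capI (S S' : L -> Prop) : graded_subring hom S -> graded_subring hom S' ->
  graded_subring hom (fun x => S x /\ S' x).
Proof.
move=> hS hS'; apply: gsub_intro; first by split; apply: gsub1.
- by move=> x y [? ?] [? ?]; split; apply: gsubB.
- by move=> x y [? ?] [? ?]; split; apply: gsubM.
- by move=> g x [? ?]; split; apply: gsub_comp.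
Qed.

Lemma gsub_full : graded_subring hom (fun _ => True).
Proof. by apply: gsub_intro. Qed.

Lemma gsub_le (S S' : L -> Prop) : graded_subring hom S -> graded_subring hom S' ->
  (forall x, homogeneous hom x -> x != 0 -> S x -> S' x) -> lsubset S S'.
Proof.
move=> hS hS' H x Sx; have [s ->] := comp_decomp x.
apply: gsub_sum => // g _; have [->|c0] := eqVneq (comp g x) 0; first exact: gsub0.
by apply: H => //; [apply: comp_homog|apply: gsub_comp].
Qed.
End Components.

(** * Extension of valuation rings *)

Section Chevalley.
Variables (G : zmodType) (L : comUnitRingType) (hom : G -> L -> Prop).
Hypothesis hL : is_graded_field hom.
Notation comp := (component hom).

(** Graded valuation rings of [L] itself; the base [l] enters as a separate inclusion, see
    [graded_val_ring_full]. *)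
Definition val_ring (O : L -> Prop) : Prop :=
  graded_subring hom O /\ forall f, homogeneous hom f -> f != 0 -> O f \/ O f^-1.

Definition adjoin (S : L -> Prop) (y : L) : L -> Prop :=
  fun x => exists p : {poly L}, (forall i, S p`_i) /\ x = p.[y].

Lemma adjoin_gen (S : L -> Prop) y : graded_subring hom S -> adjoin S y y.
Proof.
move=> hS; exists 'X; split; last by rewrite hornerX.
by move=> i; rewrite coefX; case: eqP => _; [apply: (gsub1 hS)|apply: (gsub0 hS)].
Qed.

Lemma adjoin_sub (S : L -> Prop) y : graded_subring hom S -> lsubset S (adjoin S y).
Proof.
move=> hS x Sx; exists x%:P; split; last by rewrite hornerC.
by move=> i; rewrite coefC; case: eqP => // _; apply: (gsub0 hS).
Qed.

Lemma gsub_adjoin (S : L -> Prop) y : graded_subring hom S -> homogeneous hom y ->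
  graded_subring hom (adjoin S y).
Proof.
move=> hS [h hy]; apply: gsub_intro => //.
- by apply: adjoin_sub => //; apply: (gsub1 hS).
- move=> _ _ [p [hp ->]] [q [hq ->]]; exists (p - q); rewrite hornerD hornerN.
  by split=> // i; rewrite coefB; apply: (gsubB hS).
- move=> _ _ [p [hp ->]] [q [hq ->]]; exists (p * q); rewrite hornerM.
  split=> // i; rewrite coefM; apply: (gsub_sum hS) => j _.
  exact: (gsubM hS).
move=> g _ [p [hp ->]]; exists (\poly_(i < size p) comp (g - h *+ i) p`_i); split.
  by move=> i; rewrite coef_poly; case: ifP => _; [apply: gsub_comp => //|apply: (gsub0 hS)].
rewrite horner_poly horner_coef comp_sum //; apply: eq_bigr => i _.
by rewrite (compMr hL _ _ (homX hL i hy)).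
Qed.

(** * Maximal graded subrings avoiding a set of homogeneous elements *)

Section Maximal.
Variables R X S : L -> Prop.
Hypotheses (Xhom : forall x, X x -> [/\ homogeneous hom x, x != 0 & R x^-1])
  (Xtot : forall x y, X x -> X y -> R (x / y) \/ R (y / x)).
Hypotheses (hS : graded_subring hom S) (RS : lsubset R S) (SX : forall x, X x -> ~ S x)
  (Smax : forall S' : L -> Prop, graded_subring hom S' -> lsubset S S' ->
     (forall x, X x -> ~ S' x) -> lsubset S' S).

Let one_sub_pow (z b : L) n : S z -> S b -> exists2 w, S w & (1 - z * b) ^+ n = 1 - z * w.
Proof.
move=> Sz Sb; elim: n => [|n [w Sw IH]].
  by exists 0; [apply: (gsub0 hS)|rewrite expr0 mulr0 subr0].
exists (b + w - z * b * w); last by rewrite exprS IH; ring.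
apply: (gsubB hS); first exact: (gsubD hS).
by apply: (gsubM hS) => //; apply: (gsubM hS).
Qed.

(** If [x^-1 * b] were 1, then [x = b] would lie in [S]. If the inverse of [u = 1 - x^-1 * b] were
    outside [S], maximality would put some [x'] of [X] in [S[u^-1]]; clearing denominators gives
    [x' * (1 - x^-1 * w)] in [S], and whichever of [x' / x], [x / x'] lies in [R] brings [x'] or [x]
    into [S]. *)
Let one_sub_inv x b : X x -> S b -> hom 0 (1 - x^-1 * b) ->
  1 - x^-1 * b != 0 /\ S (1 - x^-1 * b)^-1.
Proof.
move=> Xx Sb h1; have [hx x0 Rx] := Xhom Xx.
have ux := homog_unit hL hx x0.
have Sz : S x^-1 by apply: RS.
set u := 1 - _ in h1 *; have u0 : u != 0.
  rewrite /u subr_eq0; apply/eqP => e; apply: (SX Xx).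
  by rewrite -[x]mulr1 e mulrA divrr // mul1r.
have hu : homogeneous hom u by exists 0.
have uu := homog_unit hL hu u0.
split=> //; have hV := homogV hL hu.
apply: (Smax (gsub_adjoin hS hV) (@adjoin_sub S _ hS) _ (@adjoin_gen S _ hS)) => x' Xx' [p [Sp e]].
have [hx' x'0 Rx'] := Xhom Xx'; have ux' := homog_unit hL hx' x'0.
have [w Sw ew] := one_sub_pow (size p) Sz Sb.
have : S (x' * u ^+ size p).
  have E k c : (k <= size p)%N -> c * u^-1 ^+ k * u ^+ size p = c * u ^+ (size p - k).
    move=> le; rewrite -{1}(subnK le) exprD exprVn -mulrA [u ^+ _ * u ^+ k]mulrC.
    by rewrite (mulrA (u ^- k)) mulVr ?unitrX // mul1r.
  rewrite e horner_coef mulr_suml; apply: (gsub_sum hS) => i _.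
  rewrite E 1?ltnW ?ltn_ord //.
  apply: (gsubM hS) => //; apply: (gsubX hS).
  by apply: (gsubB hS); [apply: (gsub1 hS)|apply: (gsubM hS)].
rewrite ew => Se; have [/RS H|/RS H] := Xtot Xx' Xx.
  apply: (SX Xx'); have -> : x' = x' * (1 - x^-1 * w) + x' / x * w by ring.
  by apply: (gsubD hS) => //; apply: (gsubM hS).
apply: (SX Xx); have -> : x = x / x' * (x' * (1 - x^-1 * w)) + w.
  rewrite mulrA divrK // mulrBr mulr1 mulrA divrr // mul1r; ring.
by apply: (gsubD hS) => //; apply: (gsubM hS).
Qed.

(* If [x = A(y) = B(1/y)] with [deg B <= deg A], then [B] expresses [1] as a polynomial in
   [1/y] without constant term, which lowers the degree of [A]. *)
Let no_double_rep N : forall (A B : {poly L}) (x y : L) n m, (n + m <= N)%N ->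
  homogeneous hom y -> y != 0 -> X x -> (forall i, S A`_i) -> (forall i, S B`_i) ->
  (size A <= n.+1)%N -> (size B <= m.+1)%N -> x = A.[y] -> x = B.[y^-1] -> False.
Proof.
elim: N => [|N IH] A B x y n m leN hy y0 Xx SA SB sA sB eA eB.
  case: n leN sA => // _ sA; apply: (SX Xx).
  by rewrite eA (size1_polyC sA) hornerC.
wlog lemn : A B y n m leN hy y0 SA SB sA sB eA eB / (m <= n)%N.
  move=> H; case: (leqP m n) => [|/ltnW] le; first exact: (H A B y n m).
  apply: (H B A y^-1 m n); rewrite ?invr_eq0 ?invrK // 1?addnC //.
  exact: homogV.
case: n leN sA lemn => [|n] leN sA lemn.
  by apply: (SX Xx); rewrite eA (size1_polyC sA) hornerC.
have [hx x0 Rx] := Xhom Xx; have [g xg] := hx; have [h yh] := hy.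
have uy := homog_unit hL hy y0; have ux := homog_unit hL hx x0.
(* Only the components of the coefficients of [B] that contribute to the degree of [x] are kept, so
   that [x^-1 * b 0] has degree 0 and [one_sub_inv] applies. *)
pose b i := comp (g - (- h) *+ i) B`_i.
have Sb i : S (b i) by apply: gsub_comp.
have eb : x = \sum_(i < m.+1) b i * y^-1 ^+ i.
  rewrite -[LHS](comp_id hL xg) eB (horner_coef_wide _ sB) comp_sum //.
  by apply: eq_bigr => i _; rewrite (compMr hL _ _ (homX hL i (homV hL yh))).
have hb0 : hom 0 (1 - x^-1 * b 0%N).
  apply: homB => //; first exact: hom1.
  have := homM hL (homV hL xg) (comp_hom hL (g - (- h) *+ 0) B`_0).
  by rewrite mulr0n subr0 addNr /b mulr0n subr0.
have [u0 Su] := one_sub_inv Xx (Sb 0%N) hb0.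
set u := 1 - _ in u0 Su; have uu : u \is a GRing.unit by apply: (homog_unit hL) => //; exists 0.
pose d j := u^-1 * x^-1 * b j.+1.
have Sd j : S (d j) := gsubM hS (gsubM hS Su (RS Rx)) (Sb j.+1).
have ed : 1 = \sum_(j < m) d j * y^-1 ^+ j.+1.
  have eu : u = x^-1 * (x - b 0%N) by rewrite /u mulrBr mulVr.
  have ex : x - b 0%N = \sum_(j < m) b j.+1 * y^-1 ^+ j.+1.
    by rewrite {1}eb big_ord_recl expr0 mulr1 addrAC subrr add0r.
  rewrite -[LHS](mulVr uu) {2}eu ex mulrA mulr_sumr; apply: eq_bigr => i _.
  by rewrite !mulrA.
pose A' := \poly_(i < n.+1) A`_i + \sum_(j < m) (A`_n.+1 * d j) *: 'X^(n - j).
apply: (IH A' B x y n m) => //.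
- by move=> i; rewrite coefD coef_poly coef_sum; apply: (gsubD hS);
    [case: ifP => _ //; apply: (gsub0 hS)|apply: (gsub_sum hS) => j _];
    rewrite coefZ coefXn; apply: (gsubM hS); [apply: (gsubM hS)|
    case: eqP => _; [apply: (gsub1 hS)|apply: (gsub0 hS)]].
- apply: leq_trans (size_polyD _ _) _; rewrite geq_max size_poly /=.
  apply: leq_trans (size_sum _ _ _) _; apply/bigmax_leqP => j _.
  by apply: leq_trans (size_scale_leq _ _) _; rewrite size_polyXn ltnS leq_subr.
rewrite hornerD horner_poly horner_sum {1}eA (horner_coef_wide _ sA) big_ord_recr /=.
congr (_ + _); rewrite -{1}[A`_n.+1]mulr1 {1}ed mulr_sumr mulr_suml.
apply: eq_bigr => j _; rewrite hornerZ hornerXn -!mulrA; congr (_ * (_ * _)).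
have -> : (n.+1 = n - j + j.+1)%N by rewrite addnS subnK // -ltnS (leq_trans (ltn_ord j)).
by rewrite exprD; congr (_ * (_ * _)); rewrite mulrCA -exprMn mulVr // expr1n mulr1.
Qed.

(** If neither [y] nor [y^-1] is in [S], maximality gives an element of [X] in [S[y]] and another in
    [S[y^-1]]. Multiplying one by the quotient of the two that lies in [R] makes them equal, against
    [no_double_rep]. *)
Lemma maximal_val_ring : val_ring S.
Proof.
split=> // y hy y0; apply: contrapT => /not_orP[ny nyV].
have hV := homogV hL hy.
have hit z : homogeneous hom z -> ~ S z -> exists x, X x /\ adjoin S z x.
  move=> hz nz; apply: contrapT => H; apply: nz.
  apply: (Smax (gsub_adjoin hS hz) (@adjoin_sub S _ hS) _ (@adjoin_gen S _ hS)) => x Xx xz.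
  by apply: H; exists x.
have [x1 [X1 [A [SA eA]]]] := hit _ hy ny.
have [x2 [X2 [B [SB eB]]]] := hit _ hV nyV.
have [h1 n1 R1] := Xhom X1; have [h2 n2 R2] := Xhom X2.
have [/RS r|/RS r] := Xtot X1 X2.
  apply: (@no_double_rep _ A ((x1 / x2) *: B) x1 y (size A) (size B)) => //.
  - by move=> i; rewrite coefZ; apply: (gsubM hS).
  - by apply: leq_trans (size_scale_leq _ _) _.
  by rewrite hornerZ -eB divrK // (homog_unit hL h2).
apply: (@no_double_rep _ ((x2 / x1) *: A) B x2 y (size A) (size B)) => //.
- by move=> i; rewrite coefZ; apply: (gsubM hS).
- by apply: leq_trans (size_scale_leq _ _) _.
by rewrite hornerZ -eA divrK // (homog_unit hL h1).
Qed.
End Maximal.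

(* Obtained as a maximal graded subring among those containing [R] and avoiding [X]. *)
Lemma exists_val_ring (R X : L -> Prop) : graded_subring hom R ->
  (forall x, X x -> [/\ homogeneous hom x, x != 0, R x^-1 & ~ R x]) ->
  (forall x y, X x -> X y -> R (x / y) \/ R (y / x)) ->
  exists O, [/\ val_ring O, lsubset R O & forall x, X x -> ~ O x].
Proof.
move=> hR HX Xtot.
pose good S := [/\ graded_subring hom S, lsubset R S & forall x, X x -> ~ S x].
have goodR : good R by split=> // x /HX [].
pose T := {S | good S}.
pose le (s t : T) : bool := `[< lsubset (proj1_sig s) (proj1_sig t) >].
have [||| |[S gS] Smax] := @classical_sets.Zorn T le.
- by move=> t; apply/asboolP.
- by move=> r s t /asboolP h1 /asboolP h2; apply/asboolP => x /h1 /h2.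
- move=> [s gs] [t gt] /asboolP h1 /asboolP h2; have e : s = t.
    by apply: funext => x; apply: propext; split; [apply: h1|apply: h2].
  by case: _ / e in gt h1 h2 *; congr exist; apply: Prop_irrelevance.
- move=> A Atot; have [[s0 As0]|A0] := pselect (exists s, A s); last first.
    by exists (exist _ R goodR) => s As; case: A0; exists s.
  pose U x := exists s : T, A s /\ proj1_sig s x.
  have two x y : U x -> U y -> exists s : T, [/\ A s, proj1_sig s x & proj1_sig s y].
    move=> [s [As sx]] [t [At ty]]; have [/asboolP st|/asboolP ts] := Atot _ _ As At.
      by exists t; split=> //; apply: st.
    by exists s; split=> //; apply: ts.
  have gU : good U.
    split.
    - apply: gsub_intro => //.
      + by exists s0; split=> //; case: (proj2_sig s0) => h _ _; apply: (gsub1 h).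
      + move=> x y Ux Uy; have [s [As sx sy]] := two _ _ Ux Uy.
        by exists s; split=> //; case: (proj2_sig s) => h _ _; apply: (gsubB h).
      + move=> x y Ux Uy; have [s [As sx sy]] := two _ _ Ux Uy.
        by exists s; split=> //; case: (proj2_sig s) => h _ _; apply: (gsubM h).
      + move=> g x [s [As sx]]; exists s; split=> //.
        by case: (proj2_sig s) => h _ _; apply: gsub_comp.
    - by move=> x Rx; exists s0; split=> //; case: (proj2_sig s0) => _ h _; apply: h.
    - by move=> x Xx [s [As sx]]; case: (proj2_sig s) => _ _ h; apply: (h x).
  exists (exist _ U gU) => s As; apply/asboolP => x sx; by exists s.
exists S; have [hS RS SX] := gS; split=> //.
apply: (@maximal_val_ring R X) => //; first by move=> x /HX [].
move=> S' hS' SS' S'X; have gS' : good S' by split=> // x /RS /SS'.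
have e : exist _ S' gS' = exist _ S gS :> T by apply: Smax; apply/asboolP.
by have /= -> := congr1 (@proj1_sig _ _) e.
Qed.
End Chevalley.

(** * Graded valuation rings *)

Section ValuationRings.
Variables (G : zmodType) (L : comUnitRingType) (hom : G -> L -> Prop).
Hypothesis hL : is_graded_field hom.
Notation comp := (component hom).

Section OneRing.
Variable O : L -> Prop.
Hypothesis hO : val_ring hom O.
Let gO : graded_subring hom O := proj1 hO.

Lemma val_ring_notin x : homogeneous hom x -> ~ O x -> O x^-1.
Proof.
move=> hx nx; case: hO => _ /(_ x hx); case; last by [].
  by apply: contra_notN nx => /eqP ->; apply: (gsub0 gO).
by [].
Qed.

Lemma val_ring_notin_neq0 x : ~ O x -> x != 0.
Proof. by apply: contra_notN => /eqP ->; apply: (gsub0 gO). Qed.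

(** Valuation rings are integrally closed: for [x] outside [O], dividing the equation by a power of
    [x] writes [x] as a polynomial in [x^-1] over [O]. *)
Lemma val_ring_root x (p : {poly L}) : homogeneous hom x -> p \is monic ->
  (forall i, O p`_i) -> p.[x] = 0 -> O x.
Proof.
move=> hx mp hp e; apply: contrapT => nx.
have xV := val_ring_notin hx nx; have ux := homog_unit hL hx (val_ring_notin_neq0 nx).
have sp : (0 < size p)%N by rewrite size_poly_gt0 monic_neq0.
move: e; rewrite horner_coef -(prednK sp) big_ord_recr /= -lead_coefE (monicP mp) mul1r.
case: (size p).-1 => [|n].
  by rewrite big_ord0 expr0 add0r => /eqP; rewrite oner_eq0.
move/eqP; rewrite addrC addr_eq0 => /eqP e; apply: nx.
have -> : x = x ^+ n.+1 * x^-1 ^+ n by rewrite exprS -mulrA -exprMn divrr // expr1n mulr1.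
rewrite e mulNr; apply: (gsubN gO); rewrite mulr_suml; apply: (gsub_sum gO) => i _.
have -> : p`_i * x ^+ i * x^-1 ^+ n = p`_i * x^-1 ^+ (n - i).
  have le : (i <= n)%N by rewrite -ltnS.
  by rewrite exprB ?unitrV // -[(x^-1 ^+ i)^-1]exprVn invrK mulrAC mulrA.
by apply: (gsubM gO) => //; apply: (gsubX gO).
Qed.

Lemma val_ring_expn x n : homogeneous hom x -> (0 < n)%N -> O (x ^+ n) -> O x.
Proof.
move=> hx n0 Oxn; apply: (@val_ring_root x ('X^n - (x ^+ n)%:P)) => //.
- by rewrite monicXnsubC.
- move=> i; rewrite coefB coefXn coefC; apply: (gsubB gO).
    by case: eqP => _; [apply: (gsub1 gO)|apply: (gsub0 gO)].
  by case: eqP => // _; apply: (gsub0 gO).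
by rewrite !hornerE subrr.
Qed.

(** Quotients in [O] preorder the nonzero homogeneous elements totally, so a finite family has a
    term of largest absolute value; the induction compares it with each new term. *)
Lemma val_ring_dominant (I : eqType) (s : seq I) (f : I -> L) i1 :
  (forall i, homogeneous hom (f i)) -> i1 \in s -> f i1 != 0 ->
  exists i0, [/\ i0 \in s, f i0 != 0 & forall i, i \in s -> O (f i / f i0)].
Proof.
move=> hf; elim: s i1 => // a s IH i1 i1s f1.
have [[i2 i2s f2]|no] := pselect (exists2 i, i \in s & f i != 0); last first.
  have e : i1 = a.
    by move: i1s; rewrite inE => /orP[/eqP //|i1s]; case: no; exists i1.
  exists a; rewrite mem_head -e; split=> // i; rewrite inE => /orP[/eqP ->|is_].
    by rewrite divrr ?(homog_unit hL) //; apply: (gsub1 gO).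
  have -> : f i = 0 by apply/eqP; apply: contrapT => /negP ne; apply: no; exists i.
  by rewrite mul0r; apply: (gsub0 gO).
have [i0 [i0s f0 H]] := IH _ i2s f2.
have u0 := homog_unit hL (hf i0) f0.
have [Oa|na] := pselect (O (f a / f i0)).
  exists i0; rewrite inE i0s orbT; split=> // i; rewrite inE => /orP[/eqP ->|] //.
  exact: H.
have fa0 : f a != 0 by apply: contra_notN na => /eqP ->; rewrite mul0r; apply: (gsub0 gO).
have ua := homog_unit hL (hf a) fa0.
have OV := val_ring_notin (homog_div hL (hf a) (hf i0)) na.
exists a; rewrite mem_head; split=> // i; rewrite inE => /orP[/eqP ->|/H Oi].
  by rewrite divrr //; apply: (gsub1 gO).
have -> : f i / f a = f i / f i0 * (f a / f i0)^-1.
  by rewrite invrM ?unitrV // invrK mulrA divrK.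
exact: (gsubM gO).
Qed.

(* The graded maximal ideal; this form also applies to non-homogeneous elements. *)
Definition max_ideal (y : L) : Prop :=
  y = 0 \/ exists z, [/\ homogeneous hom z, ~ O z & O (z * y)].

Lemma max_ideal_sub : lsubset max_ideal O.
Proof.
move=> y [->|[z [hz nz Ozy]]]; first exact: (gsub0 gO).
have uz := homog_unit hL hz (val_ring_notin_neq0 nz).
rewrite -[y](mulKr uz); apply: (gsubM gO) => //; exact: val_ring_notin.
Qed.

Lemma max_idealMl a y : O a -> max_ideal y -> max_ideal (a * y).
Proof.
move=> Oa [->|[z [hz nz Ozy]]]; first by rewrite mulr0; left.
by right; exists z; split=> //; rewrite mulrCA; apply: (gsubM gO).
Qed.

Lemma max_idealD x y : max_ideal x -> max_ideal y -> max_ideal (x + y).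
Proof.
move=> [->|[z [hz nz Ozx]]]; first by rewrite add0r.
move=> [->|[w [hw nw Owy]]]; first by rewrite addr0; right; exists z.
have z0 := val_ring_notin_neq0 nz; have w0 := val_ring_notin_neq0 nw.
have uz := homog_unit hL hz z0; have uw := homog_unit hL hw w0.
have hzw := homog_div hL hz hw; right.
(* Of the two witnesses, the one that is an [O]-multiple of the other serves both summands. *)
have [Ozw|nzw] := pselect (O (z / w)).
  exists z; split=> //; rewrite mulrDr; apply: (gsubD gO) => //.
  have -> : z * y = z / w * (w * y) by rewrite mulrA divrK.
  exact: (gsubM gO).
exists w; split=> //; rewrite mulrDr; apply: (gsubD gO) => //.
have := val_ring_notin hzw nzw; rewrite invrM ?unitrV // invrK => Owz.
have -> : w * x = w / z * (z * x) by rewrite mulrA divrK.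
exact: (gsubM gO).
Qed.

Lemma max_idealN y : max_ideal y -> max_ideal (- y).
Proof. by rewrite -mulN1r => h; apply: max_idealMl => //; apply: (gsubN gO); apply: (gsub1 gO). Qed.

Lemma max_idealB x y : max_ideal x -> max_ideal y -> max_ideal (x - y).
Proof. by move=> hx hy; apply: max_idealD => //; apply: max_idealN. Qed.

Lemma max_ideal_sum I (r : seq I) (P : pred I) (F : I -> L) :
  (forall i, P i -> max_ideal (F i)) -> max_ideal (\sum_(i <- r | P i) F i).
Proof. by move=> h; apply: big_ind => //; [left|apply: max_idealD]. Qed.

Lemma max_ideal_comp g y : max_ideal y -> max_ideal (comp g y).
Proof.
move=> [->|[z [hz nz Ozy]]]; first by rewrite comp0 //; left.
right; exists z; split=> //; have [h zh] := hz.
by rewrite -[g](addKr h) addrC -(compMl hL _ _ zh); apply: gsub_comp.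
Qed.

Lemma max_ideal_unit y : y \is a GRing.unit -> O y^-1 -> ~ max_ideal y.
Proof.
move=> uy Oy [e|[z [hz nz Ozy]]]; first by rewrite e unitr0 in uy.
by apply: nz; rewrite -[z](mulrK uy); apply: (gsubM gO).
Qed.

Lemma max_ideal_homog y : homogeneous hom y -> ~ O y^-1 -> max_ideal y.
Proof.
move=> hy ny; right; exists y^-1; split=> //; first exact: homogV.
rewrite mulVr; first exact: (gsub1 gO).
by apply: (homog_unit hL hy); have := val_ring_notin_neq0 ny; rewrite invr_eq0.
Qed.

Lemma max_ideal1 : ~ max_ideal 1.
Proof. by apply: max_ideal_unit; rewrite ?unitr1 // invr1; apply: (gsub1 gO). Qed.

(** This is [k] plus the maximal ideal, the preimage in [O] of the image of [k] in the residue ring;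
    both refinements of [O] below start from it. *)
Lemma gsub_add_max_ideal (k : L -> Prop) : graded_subring hom k -> lsubset k O ->
  graded_subring hom (fun x => exists2 c, k c & max_ideal (x - c)).
Proof.
move=> hk kO; apply: gsub_intro => //.
- by exists 1; [apply: (gsub1 hk)|rewrite subrr; left].
- move=> x y [c kc hc] [d kd hd]; exists (c - d); first exact: (gsubB hk).
  have -> : x - y - (c - d) = (x - c) - (y - d) by ring.
  exact: max_idealB.
- move=> x y [c kc hc] [d kd hd]; exists (c * d); first exact: (gsubM hk).
  have -> : x * y - c * d = (x - c + c) * (y - d) + d * (x - c) by ring.
  apply: max_idealD; apply: max_idealMl => //; last exact: kO.
  by apply: (gsubD gO); [apply: max_ideal_sub|apply: kO].
- move=> g x [c kc hc]; exists (comp g c); first exact: gsub_comp.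
  by rewrite -compB //; apply: max_ideal_comp.
Qed.
End OneRing.

End ValuationRings.

(** * Graded polynomials *)

Section GradedPolynomials.
Variables (G : zmodType) (L : comUnitRingType) (hom : G -> L -> Prop).
Hypothesis hL : is_graded_field hom.
Notation comp := (component hom).

Definition coefs_in n (S : L -> Prop) (p : {mpoly L[n]}) : Prop := forall m, S p@_m.

Section Coefs.
Variables (S : L -> Prop) (n : nat).
Hypothesis hS : graded_subring hom S.
Implicit Types p q : {mpoly L[n]}.

Lemma coefs_inB p q : coefs_in S p -> coefs_in S q -> coefs_in S (p - q).
Proof. by move=> hp hq m; rewrite mcoeffB; apply: (gsubB hS). Qed.
Lemma coefs_inM p q : coefs_in S p -> coefs_in S q -> coefs_in S (p * q).
Proof.
by move=> hp hq m; rewrite mcoeffM; apply: (gsub_sum hS) => k _; apply: (gsubM hS).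
Qed.
Lemma coefs_inZ c p : S c -> coefs_in S p -> coefs_in S (c *: p).
Proof. by move=> hc hp m; rewrite mcoeffZ; apply: (gsubM hS). Qed.
Lemma coefs_inX m : coefs_in S ('X_[m] : {mpoly L[n]}).
Proof.
by move=> m'; rewrite mcoeffX; case: eqP => _; [apply: (gsub1 hS)|apply: (gsub0 hS)].
Qed.
Lemma coefs_inC c : S c -> coefs_in S (c%:MP : {mpoly L[n]}).
Proof.
move=> hc m; rewrite mcoeffC; apply: (gsubM hS) => //.
by case: eqP => _; [apply: (gsub1 hS)|apply: (gsub0 hS)].
Qed.
Lemma coefs_in_sum I (r : seq I) (P : pred I) (F : I -> {mpoly L[n]}) :
  (forall i, P i -> coefs_in S (F i)) -> coefs_in S (\sum_(i <- r | P i) F i).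
Proof.
move=> h; apply: big_ind => //; first by move=> m; rewrite mcoeff0; apply: (gsub0 hS).
by move=> p q hp hq m; rewrite mcoeffD; apply: (gsubD hS).
Qed.
End Coefs.

Lemma coefs_in_sub n (S S' : L -> Prop) (p : {mpoly L[n]}) :
  lsubset S S' -> coefs_in S p -> coefs_in S' p.
Proof. by move=> le hp m; apply: le. Qed.

Section Weights.
Variables (n : nat) (v : 'I_n -> L) (d : 'I_n -> G).
Hypothesis hv : forall i, hom (d i) (v i).

Definition mon (m : 'X_{1..n}) : L := \prod_i v i ^+ m i.
Definition weight (m : 'X_{1..n}) : G := \sum_i d i *+ m i.

Lemma monD m1 m2 : mon (m1 + m2)%MM = mon m1 * mon m2.
Proof. by rewrite -big_split; apply: eq_bigr => i _; rewrite mnmDE exprD. Qed.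

Lemma mon0 : mon 0%MM = 1.
Proof. by rewrite /mon big1 // => i _; rewrite mnm0E expr0. Qed.

Lemma meval_mon p : p.@[v] = \sum_(m <- msupp p) p@_m * mon m.
Proof. exact: mevalE. Qed.

Lemma mon_hom m : hom (weight m) (mon m).
Proof. by apply: (hom_prod hL) => i; apply: homX. Qed.

Lemma mon_unit m : (forall i, v i != 0) -> mon m \is a GRing.unit.
Proof.
move=> v0; rewrite /mon; elim/big_ind: _ => [|x y|i _]; first exact: unitr1.
  by move=> ux uy; rewrite unitrM ux.
by apply: unitrX; apply: (homog_unit hL _ (v0 i)); exists (d i).
Qed.

(** The homogeneous component for the grading of the polynomial ring in which the variable [i] has
    degree [d i]; evaluation at [v] respects this grading. *)
Definition hpart (g : G) (p : {mpoly L[n]}) : {mpoly L[n]} :=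
  \sum_(m <- msupp p) comp (g - weight m) p@_m *: 'X_[m].

Lemma mcoeff_hpart g p m : (hpart g p)@_m = comp (g - weight m) p@_m.
Proof.
rewrite /hpart (raddf_sum (mcoeff m)) /=; have [ms|/negPf ms] := boolP (m \in msupp p).
  rewrite (bigD1_seq m) ?msupp_uniq //= mcoeffZ mcoeffX eqxx mulr1 big1 ?addr0 //.
  by move=> i /negPf ne; rewrite mcoeffZ mcoeffX ne mulr0.
rewrite (_ : p@_m = 0) ?comp0 ?big_seq ?big1 //.
  move=> i is_; rewrite mcoeffZ mcoeffX; case: eqP => [e|_]; last by rewrite mulr0.
  by rewrite -e is_ in ms.
by apply/eqP; rewrite mcoeff_eq0 ms.
Qed.

Lemma meval_hpart g p : (hpart g p).@[v] = comp g p.@[v].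
Proof.
rewrite [in RHS]meval_mon comp_sum // /hpart (raddf_sum (meval v)) /=; apply: eq_bigr => m _.
by rewrite mevalZ mevalX (compMr hL _ _ (mon_hom m)).
Qed.

Lemma coefs_in_hpart g p S : graded_subring hom S -> coefs_in S p -> coefs_in S (hpart g p).
Proof. by move=> hS hp m; rewrite mcoeff_hpart; apply: gsub_comp. Qed.

Lemma hpart_hom g p m : hom (g - weight m) (hpart g p)@_m.
Proof. by rewrite mcoeff_hpart; apply: comp_hom. Qed.

Lemma exists_hpart_neq0 p : p != 0 -> exists g, hpart g p != 0.
Proof.
move=> p0; pose m := mlead p.
have [g c0] : exists g, comp g p@_m != 0.
  apply: contrapT => no; move: p0; rewrite -mleadc_eq0 => /negP; apply; apply/eqP.
  by apply: (comp_eq0 hL) => g; apply/eqP; apply: contrapT => /negP c0; apply: no; exists g.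
exists (g + weight m); apply: contraNneq c0 => e.
by have := mcoeff_hpart (g + weight m) p m; rewrite e mcoeff0 addrK => <-.
Qed.
End Weights.

(** Independence quantifies over all polynomials; since evaluation respects degrees, a nonzero
    homogeneous component of a relation is again a relation. *)
Lemma homog_relation n (v : 'I_n -> L) (d : 'I_n -> G) (S : L -> Prop) :
  (forall i, hom (d i) (v i)) -> graded_subring hom S -> ~ alg_indep S v ->
  exists (p : {mpoly L[n]}) (g : G), [/\ p != 0, coefs_in S p, p.@[v] = 0 &
    forall m, hom (g - weight d m) p@_m].
Proof.
move=> hv hS /existsNP[p /not_implyP[hp /not_implyP[e /eqP p0]]].
have [g q0] := exists_hpart_neq0 d p0.
exists (hpart d g p), g; split=> //; first exact: coefs_in_hpart.
  by rewrite (meval_hpart hv) e comp0.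
by move=> m; apply: hpart_hom.
Qed.
End GradedPolynomials.

(** * General position implies surjectivity *)

Section Extension.
Variables (G : zmodType) (L : comUnitRingType) (hom : G -> L -> Prop).
Hypothesis hL : is_graded_field hom.
Notation comp := (component hom).

Definition extend_family T n (v : 'I_n -> T) (x : T) : 'I_n.+1 -> T :=
  fun i => if unlift ord_max i is Some j then v j else x.

Lemma extend_family_max T n (v : 'I_n -> T) x : extend_family v x ord_max = x.
Proof. by rewrite /extend_family unlift_none. Qed.

Lemma extend_family_lift T n (v : 'I_n -> T) x i :
  extend_family v x (lift ord_max i) = v i.
Proof. by rewrite /extend_family liftK. Qed.

Definition restrict_mnm n (m : 'X_{1..n.+1}) : 'X_{1..n} :=
  [multinom m (lift ord_max i) | i < n].

Lemma restrict_mnm_inj n (m m' : 'X_{1..n.+1}) :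
  restrict_mnm m = restrict_mnm m' -> m ord_max = m' ord_max -> m = m'.
Proof.
move=> /mnmP e e'; apply/mnmP => i.
by case: (unliftP ord_max i) => [j ->|-> //]; have := e j; rewrite !mnmE.
Qed.

Lemma mon_extend n (v : 'I_n -> L) x m :
  mon (extend_family v x) m = mon v (restrict_mnm m) * x ^+ m ord_max.
Proof.
rewrite /mon (bigD1_ord ord_max) //= extend_family_max mulrC; congr (_ * _).
by apply: eq_bigr => i _; rewrite extend_family_lift mnmE.
Qed.

Lemma weight_extend n (d : 'I_n -> G) e m :
  weight (extend_family d e) m = weight d (restrict_mnm m) + e *+ m ord_max.
Proof.
rewrite /weight (bigD1_ord ord_max) //= extend_family_max addrC; congr (_ + _).
by apply: eq_bigr => i _; rewrite extend_family_lift mnmE.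
Qed.

Lemma mnm0_eq (m : 'X_{1..0}) : m = 0%MM.
Proof. by apply/mnmP => -[]. Qed.

Lemma alg_indep_empty (S : L -> Prop) (v : 'I_0 -> L) : alg_indep S v.
Proof.
move=> p _; have -> : p = (p@_0%MM)%:MP.
  by apply/mpolyP => m; rewrite mcoeffC (mnm0_eq m) eqxx mulr1.
by rewrite mevalC => ->; rewrite mpolyC0.
Qed.

Lemma alg_indep_inj (S : L -> Prop) n (v : 'I_n -> L) : graded_subring hom S ->
  alg_indep S v -> injective v.
Proof.
move=> hS ind i j e; apply/eqP; apply: contraT => ne.
have /mpolyP /(_ U_(i)%MM) : ('X_i - 'X_j : {mpoly L[n]}) = 0.
  apply: ind; first by apply: (coefs_inB hS); apply: (coefs_inX hS).
  by rewrite mevalB !mevalXU e subrr.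
rewrite mcoeffB mcoeff0 !mcoeffXU eqxx eq_sym (negPf ne) subr0 => /eqP.
by rewrite oner_eq0.
Qed.

(* [O] contains the graded field generated by [v] over [k]. *)
Definition frac_closed (k : L -> Prop) n (v : 'I_n -> L) (O : L -> Prop) : Prop :=
  forall p : {mpoly L[n]}, coefs_in k p ->
    O p.@[v] /\ (homogeneous hom p.@[v] -> p.@[v] != 0 -> O (p.@[v])^-1).

Lemma frac_closed_restrict k n (v : 'I_n -> L) x O : graded_subring hom k ->
  frac_closed k (extend_family v x) O -> frac_closed k v O.
Proof.
move=> hk H p kp.
pose emb (m : 'X_{1..n}) := [multinom extend_family m 0%N i | i < n.+1].
pose p' : {mpoly L[n.+1]} := \sum_(m <- msupp p) p@_m *: 'X_[emb m].
have kp' : coefs_in k p'.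
  by apply: (coefs_in_sum hk) => m _; apply: (coefs_inZ hk) => //; apply: (coefs_inX hk).
have e : p'.@[extend_family v x] = p.@[v].
  rewrite [in RHS]meval_mon (raddf_sum (meval _)) /=; apply: eq_bigr => m _.
  rewrite mevalZ mevalX; congr (_ * _).
  rewrite (_ : \prod_(i < _) _ = mon (extend_family v x) (emb m)) // mon_extend.
  rewrite mnmE extend_family_max expr0 mulr1; congr (mon v _).
  by apply/mnmP => i; rewrite !mnmE extend_family_lift.
by have := H p' kp'; rewrite e.
Qed.

(** Read the relation as a polynomial [C] in the last variable. Independence of [v] keeps its
    leading coefficient nonzero at [v]; the value there is homogeneous, so its inverse is in [O],
    and dividing by it makes [x] integral over [O]. *)
Lemma frac_closed_dependent k n (v : 'I_n -> L) x O :
  (forall i, homogeneous hom (v i)) -> homogeneous hom x -> graded_subring hom k ->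
  alg_indep k v -> ~ alg_indep k (extend_family v x) -> val_ring hom O ->
  frac_closed k v O -> O x.
Proof.
move=> /choice[d hd] [e hx] hk ind nind hO H.
have hext i : hom (extend_family d e i) (extend_family v x i).
  by rewrite /extend_family; case: unliftP.
have [p [g [p0 kp pv hp]]] := homog_relation hL hext hk nind.
pose c m : {mpoly L[n]} := p@_m *: 'X_[restrict_mnm m].
pose C : {poly {mpoly L[n]}} := \sum_(m <- msupp p) c m *: 'X^(m ord_max).
have coefCE j : C`_j = \sum_(m <- msupp p | m ord_max == j) c m.
  rewrite coef_sum [RHS]big_mkcond; apply: eq_bigr => m _.
  by rewrite coefZ coefXn eq_sym; case: eqP; rewrite ?mulr1 ?mulr0.
have kC j : coefs_in k C`_j.
  rewrite coefCE; apply: (coefs_in_sum hk) => m _.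
  by apply: (coefs_inZ hk) => //; apply: (coefs_inX hk).
have homC j : homogeneous hom (C`_j).@[v].
  exists (g - e *+ j); rewrite coefCE (raddf_sum (meval v)) /=; apply: hom_sum => // m /eqP <-.
  rewrite mevalZ mevalX; have := homM hL (hp m) (mon_hom hL hd (restrict_mnm m)).
  by rewrite weight_extend opprD addrA addrAC subrK.
(* The exponents of [v] and of [x] together determine a monomial, so nothing cancels in the
   coefficients of [C]. *)
have C0 : C != 0.
  pose m := mlead p; apply: contraTneq (mlead_supp p0) => eC.
  have : (C`_(m ord_max))@_(restrict_mnm m) = 0 by rewrite eC coef0 mcoeff0.
  rewrite coefCE (raddf_sum (mcoeff _)) big_mkcond /= => e0; apply/negP => ms.
  have pm : p@_m = 0.
    rewrite -[RHS]e0 (bigD1_seq m) ?msupp_uniq //= eqxx mcoeffZ mcoeffX eqxx mulr1.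
    rewrite big1 ?addr0 // => m' ne; case: eqP => // em; rewrite mcoeffZ mcoeffX.
    case: eqP => [em'|_]; last by rewrite mulr0.
    by rewrite (restrict_mnm_inj em' em) eqxx in ne.
  by move: p0; rewrite -mleadc_eq0 -/m pm eqxx.
pose a := (lead_coef C).@[v].
have a0 : a != 0.
  apply: contra_neq C0 => ea; apply/eqP; rewrite -lead_coef_eq0; apply/eqP.
  exact: (ind _ (kC _) ea).
have ua : a \is a GRing.unit := homog_unit hL (homC _) a0.
have OaV : O a^-1 by apply: (proj2 (H _ (kC _))) => //; apply: homC.
pose Q := \poly_(i < size C) (a^-1 * (C`_i).@[v]).
have Q1 : a^-1 * (C`_(size C).-1).@[v] = 1 by rewrite mulVr.
have mQ : Q \is monic.
  by rewrite monicE lead_coef_poly ?size_poly_gt0 ?Q1 ?oner_neq0.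
apply: (val_ring_root hL hO _ mQ); first by exists e.
  move=> i; rewrite coef_poly; case: ifP => _; last exact: (gsub0 (proj1 hO)).
  by apply: (gsubM (proj1 hO)) => //; case: (H _ (kC i)).
have -> : Q.[x] = a^-1 * (map_poly (meval v) C).[x].
  rewrite /map_poly !horner_poly mulr_sumr.
  by apply: eq_bigr => i _; rewrite mulrA.
have -> : (map_poly (meval v) C).[x] = p.@[extend_family v x].
  rewrite meval_mon (raddf_sum (map_poly (meval v))) /= horner_sum; apply: eq_bigr => m _.
  rewrite map_polyZ map_polyXn hornerZ hornerXn mon_extend mulrA.
  by congr (_ * _); rewrite -[LHS]/(meval v (c m)) mevalZ mevalX.
by rewrite pv mulr0.
Qed.

Section Surjectivity.
Variables l K k : L -> Prop.
Hypotheses (hl : graded_subfield hom l) (hK : graded_subfield hom K)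
  (hk : graded_subfield hom k) (hkl : lsubset k l) (hkK : lsubset k K).

(** Elements of [s] are appended to [v] as long as independence survives; every other one depends
    algebraically on [v] and falls under [frac_closed_dependent]. *)
Lemma exists_transcendence_family (s : seq L) :
  (forall x, x \in s -> [/\ l x, homogeneous hom x & x != 0]) ->
  exists n (v : 'I_n -> L), [/\ forall i, [/\ l (v i), homogeneous hom (v i) & v i != 0],
    alg_indep k v & forall O, val_ring hom O -> frac_closed k v O ->
      forall x, x \in s -> O x].
Proof.
elim: s => [|x s IH] hs.
  by exists 0%N, (fun=> 0); split=> [[]||] //; apply: alg_indep_empty.
have [|n [v [hv ind H]]] := IH; first by move=> y ys; apply: hs; rewrite inE ys orbT.
have [lx hx x0] := hs x (mem_head _ _).
have [ind'|nind] := pselect (alg_indep k (extend_family v x)).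
  exists n.+1, (extend_family v x); split=> //.
    by move=> i; rewrite /extend_family; case: unliftP.
  move=> O hO HO y; rewrite inE => /orP[/eqP ->|]; last first.
    by apply: H => //; apply: frac_closed_restrict HO; case: hk.
  have kX : coefs_in k ('X_ord_max : {mpoly L[n.+1]}) by apply: (@coefs_inX _ _ hom); case: hk.
  by have [+ _] := HO _ kX; rewrite mevalXU extend_family_max.
exists n, v; split=> // O hO HO y; rewrite inE => /orP[/eqP ->|]; last exact: H.
apply: (frac_closed_dependent _ hx _ ind nind) => //; last by case: hk.
by move=> i; case: (hv i).
Qed.

Hypothesis gp : general_position hom k l K.
Variable O' : L -> Prop.
Hypothesis hO' : graded_val_ring hom K k O'.

Let O'K : lsubset O' K. Proof. by case: hO'. Qed.
Let gO' : graded_subring hom O'. Proof. by case: hO'. Qed.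
Let kO' : lsubset k O'. Proof. by case: hO'. Qed.
Let gk : graded_subring hom k. Proof. by case: hk. Qed.
Let gK : graded_subring hom K. Proof. by case: hK. Qed.
Let outside (x : L) := [/\ K x, homogeneous hom x & ~ O' x].

Let outside_neq0 x : outside x -> x != 0.
Proof. by case=> _ _; apply: contra_notN => /eqP ->; apply: (gsub0 gO'). Qed.

Let outsideV x : outside x -> O' x^-1.
Proof.
move=> ox; have [Kx hx nx] := ox; case: hO' => _ _ _ /(_ x Kx hx (outside_neq0 ox)).
by case.
Qed.

Let outside_tot x y : outside x -> outside y -> O' (x / y) \/ O' (y / x).
Proof.
move=> ox oy; have [Kx hx _] := ox; have [Ky hy _] := oy.
have x0 := outside_neq0 ox; have y0 := outside_neq0 oy.
have ux := homog_unit hL hx x0; have uy := homog_unit hL hy y0.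
case: hO' => _ _ _ /(_ (x / y)); rewrite invrM ?unitrV // invrK; apply.
- by apply: (gsubM gK) => //; case: hK => _; apply.
- exact: homog_div.
- exact: (homog_div_neq0 hL).
Qed.

Let val_ring_family n (v : 'I_n -> L) :
  (forall i, [/\ l (v i), homogeneous hom (v i) & v i != 0]) -> alg_indep k v ->
  exists O, [/\ val_ring hom O, lsubset O' O, forall x, outside x -> ~ O x &
    frac_closed k v O].
Proof.
(* [general_position] asks for an injective family, and independent families are injective. *)
move=> hv indk; have indK := gp (alg_indep_inj gk indk) hv indk.
have /choice[d hd] : forall i, exists g, hom g (v i) by move=> i; case: (hv i).
(* [R] consists of the fractions [p(v) / g(v)] with [p] over [O'] and [g] over [k]; the value of a
   denominator must be homogeneous and nonzero, hence a unit. *)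
pose frac (y : L) (p g : {mpoly L[n]}) := [/\ coefs_in O' p, coefs_in k g,
  homogeneous hom g.@[v], g.@[v] != 0 & y * g.@[v] = p.@[v]].
pose R y := exists p g, frac y p g.
have k1 : coefs_in k (1 : {mpoly L[n]}) by apply: (coefs_inC gk); apply: (gsub1 gk).
have R_poly p : coefs_in O' p -> R p.@[v].
  move=> hp; exists p, 1; rewrite /frac meval1 oner_neq0 mulr1; split=> //.
  exact: homog1.
have gR : graded_subring hom R.
  apply: gsub_intro => //.
  - by rewrite -(meval1 v); apply: R_poly; apply: coefs_in_sub k1.
  - move=> x y [p [g [Op kg hg g0 e]]] [p' [g' [Op' kg' hg' g0' e']]].
    exists (p * g' - p' * g), (g * g'); rewrite /frac mevalB !mevalM; split.
    + by apply: (coefs_inB gO'); apply: (coefs_inM gO') => //; apply: coefs_in_sub kO' _.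
    + exact: (coefs_inM gk).
    + exact: homogM.
    + exact: (homogM_neq0 hL).
    + by rewrite -e -e'; ring.
  - move=> x y [p [g [Op kg hg g0 e]]] [p' [g' [Op' kg' hg' g0' e']]].
    exists (p * p'), (g * g'); rewrite /frac !mevalM; split.
    + exact: (coefs_inM gO').
    + exact: (coefs_inM gk).
    + exact: homogM.
    + exact: (homogM_neq0 hL).
    + by rewrite -e -e'; ring.
  - move=> h x [p [g [Op kg [c hg] g0 e]]].
    exists (hpart hom d (h + c) p), g; split=> //; first exact: coefs_in_hpart.
      by exists c.
    by rewrite (meval_hpart hL hd) -e (compMr hL _ _ hg) addrK.
have [||O [hO RO XO]] := @exists_val_ring _ _ _ hL R outside gR.
- move=> x ox; split; [by case: ox|exact: outside_neq0| |].
    rewrite -(mevalC v x^-1); apply: R_poly; apply: (coefs_inC gO').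
    exact: outsideV.
  have [Kx [c hx] nx] := ox => -[p [g [Op kg hg g0 e]]]; apply: nx.
  (* Independence over [K] lifts the equality of values to [x *: g = p]. A nonzero component [c] of
     a coefficient of [g] is invertible in [k], and [x * c] is a component of a coefficient of [p],
     so [x] lies in [O']. *)
  have eq0 : x *: g - p = 0.
    apply: indK; last by rewrite mevalB mevalZ e subrr.
    apply: (coefs_inB gK); last exact: coefs_in_sub Op.
    by apply: (coefs_inZ gK) => //; apply: coefs_in_sub kg.
  have eg m : x * g@_m = p@_m.
    by apply/eqP; rewrite -subr_eq0 -mcoeffZ -mcoeffB eq0 mcoeff0.
  have gn0 : g != 0 by apply: contraNneq g0 => ->; rewrite meval0.
  pose m := mlead g; have [h c0] : exists h, comp h g@_m != 0.
    apply: contrapT => no; move: gn0; rewrite -mleadc_eq0 => /negP; apply; apply/eqP.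
    by apply: (comp_eq0 hL) => h; apply/eqP; apply: contrapT => /negP c0; apply: no; exists h.
  have hc := comp_homog hL h g@_m; have uc := homog_unit hL hc c0.
  rewrite -[x](mulrK uc); apply: (gsubM gO'); last first.
    by apply: kO'; case: hk => _; apply=> //; apply: gsub_comp.
  have -> : x * comp h g@_m = comp (h + c) p@_m by rewrite -eg (compMl hL _ _ hx) addrK.
  exact: gsub_comp.
- move=> x y ox oy; have [H|H] := outside_tot ox oy; [left|right];
    by rewrite -(mevalC v (_ / _)); apply: R_poly; apply: (coefs_inC gO').
exists O; split=> //.
  by move=> y Oy; apply: RO; rewrite -(mevalC v y); apply: R_poly; apply: (coefs_inC gO').
move=> p kp; split; first by apply: RO; apply: R_poly; apply: coefs_in_sub kp.
move=> hp p0; apply: RO; exists 1, p; split=> //; first exact: coefs_in_sub k1.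
by rewrite mulVr ?meval1 // (homog_unit hL).
Qed.

Lemma general_position_extension :
  exists O, [/\ val_ring hom O, lsubset l O & lseteq (psi K O) O'].
Proof.
have [gl lV] := hl.
(* [R] is the ring [l[O']]; taking the factors from [l] homogeneous makes closure under components
   direct. *)
pose good (ab : L * L) := [/\ l ab.1, homogeneous hom ab.1 & O' ab.2].
pose R y := exists s : seq (L * L), (forall ab, ab \in s -> good ab) /\
  y = \sum_(ab <- s) ab.1 * ab.2.
have gR : graded_subring hom R.
  apply: gsub_intro => //.
  - exists [:: (1, 1)]; rewrite big_seq1 mulr1; split=> // ab; rewrite inE => /eqP ->.
    by split; [apply: (gsub1 gl)|apply: homog1|apply: (gsub1 gO')].
  - move=> _ _ [s [hs ->]] [t [ht ->]]; exists (s ++ [seq (- ab.1, ab.2) | ab <- t]); split.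
      move=> ab; rewrite mem_cat => /orP[/hs //|/mapP[cd /ht [h1 [g h2] h3] ->]].
      by split=> //=; [apply: (gsubN gl)|exists g; apply: homN].
    rewrite big_cat big_map /= -sumrN; congr (_ + _).
    by apply: eq_bigr => ab _; rewrite mulNr.
  - move=> _ _ [s [hs ->]] [t [ht ->]].
    exists [seq (x.1 * y.1, x.2 * y.2) | x <- s, y <- t]; split.
      move=> ab /allpairsP[[x y] /= [/hs [h1 h2 h3] /ht [h1' h2' h3'] ->]].
      by split=> /=; [apply: (gsubM gl)|apply: homogM|apply: (gsubM gO')].
    rewrite big_allpairs_dep mulr_suml /=; apply: eq_bigr => x _.
    by rewrite mulr_sumr; apply: eq_bigr => y _ /=; ring.
  - move=> g _ [s [hs ->]].
    have [h hh] : exists h : L -> G, forall ab, ab \in s -> hom (h ab.1) ab.1.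
      have /choice[h hh] : forall x, exists g, homogeneous hom x -> hom g x.
        by move=> x; have [[c hc]|nh] := pselect (homogeneous hom x); [exists c|exists 0].
      by exists h => ab /hs [_ + _]; apply: hh.
    exists [seq (ab.1, comp (g - h ab.1) ab.2) | ab <- s]; split.
      by move=> _ /mapP[ab /hs [h1 h2 h3] ->]; split=> //=; apply: gsub_comp.
    rewrite comp_sum // big_map; apply: eq_big_seq => ab /hh hab /=.
    by rewrite (compMl hL _ _ hab).
have O'R : lsubset O' R.
  move=> y Oy; exists [:: (1, y)]; rewrite big_seq1 mul1r; split=> // ab; rewrite inE => /eqP ->.
  by split=> //=; [apply: (gsub1 gl)|apply: homog1].
have lR : lsubset l R.
  move=> y ly; have [s e] := comp_decomp hL y; exists [seq (comp g y, 1) | g <- s]; split.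
    move=> _ /mapP[g _ ->]; split=> /=; first exact: gsub_comp.
      exact: comp_homog.
    exact: (gsub1 gO').
  by rewrite big_map {1}e; apply: eq_bigr => g _; rewrite mulr1.
have [||O [hO RO XO]] := @exists_val_ring _ _ _ hL R outside gR.
- move=> x ox; split; [by case: ox|exact: outside_neq0|by apply: O'R; apply: outsideV|].
  move=> [s [hs e]].
  (* The nonzero factors from [l] lie in every valuation ring closed under fractions in [v]. The one
     from [val_ring_family] also contains [O'], so it would contain [x], which it avoids. *)
  have [n [v [hv ind H]]] : exists n (v : 'I_n -> L),
      [/\ forall i, [/\ l (v i), homogeneous hom (v i) & v i != 0],
      alg_indep k v & forall O, val_ring hom O -> frac_closed k v O ->
      forall x, x \in [seq ab.1 | ab <- s & ab.1 != 0] -> O x].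
    apply: exists_transcendence_family => _ /mapP[ab + ->].
    by rewrite mem_filter => /andP[ab0 /hs[]].
  have [O [hO O'O oO fO]] := val_ring_family hv ind.
  apply: (oO x ox); rewrite e big_seq; apply: (gsub_sum (proj1 hO)) => ab abs.
  have [_ _ O'b] := hs _ abs; apply: (gsubM (proj1 hO)); last exact: O'O.
  have [->|a0] := eqVneq ab.1 0; first exact: (gsub0 (proj1 hO)).
  by apply: (H O hO fO); apply/mapP; exists ab; rewrite // mem_filter a0.
- by move=> x y ox oy; have [/O'R|/O'R] := outside_tot ox oy; [left|right].
exists O; split=> //; first by move=> y /lR /RO.
move=> x; split=> [[Ox Kx]|O'x]; last by split; [apply: RO; apply: O'R|apply: O'K].
apply: (gsub_le hL (gsub_capI hL (proj1 hO) gK) gO') (conj Ox Kx).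
move=> y hy _ [Oy Ky]; apply: contrapT => ny; exact: (XO y).
Qed.
End Surjectivity.
End Extension.

(** * Residue fields and refinements *)

Section Residues.
Variables (G : zmodType) (L : comUnitRingType) (hom : G -> L -> Prop).
Hypothesis hL : is_graded_field hom.
Notation comp := (component hom).
Notation max_ideal := (max_ideal hom).

(** For homogeneous [y], an inverse missing from [O] is missing from the smaller ring. This carries
    congruences modulo the maximal ideal of [O] over to refinements. *)
Lemma max_ideal_anti (O O' : L -> Prop) : val_ring hom O -> val_ring hom O' ->
  lsubset O' O -> lsubset (max_ideal O) (max_ideal O').
Proof.
move=> hO hO' le y my; have [s ->] := comp_decomp hL y.
apply: (max_ideal_sum hL hO') => g _; have hg := comp_homog hL g y.
have [->|c0] := eqVneq (comp g y) 0; first by left.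
apply: (max_ideal_homog hL hO' hg) => /le OV.
by apply: (max_ideal_unit hO (homog_unit hL hg c0) OV); apply: max_ideal_comp.
Qed.

(** For [x] in [O]: the residue of [x] is integral over the image of [k]. As [q] has positive
    degree, its constant term can be changed while it stays monic, as [val_ring_monic] does. *)
Definition algebraic_mod (k O : L -> Prop) (x : L) : Prop :=
  exists q : {poly L}, [/\ q \is monic, (1 < size q)%N, forall i, k q`_i & max_ideal O q.[x]].

Lemma val_ring_monic (O : L -> Prop) x (q : {poly L}) : val_ring hom O ->
  homogeneous hom x -> q \is monic -> (1 < size q)%N -> (forall i, O q`_i) -> O q.[x] -> O x.
Proof.
move=> hO hx mq sq kq Oq; have gO := proj1 hO.
apply: (val_ring_root hL hO (p := q - q.[x]%:P)) => //.
- by rewrite monicE lead_coefDl ?size_polyN ?(leq_ltn_trans (size_polyC_leq1 _)).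
- by move=> i; rewrite coefB coefC; apply: (gsubB gO) => //; case: eqP => // _; apply: (gsub0 gO).
by rewrite hornerD hornerN hornerC subrr.
Qed.

(* Adjoin [1/x] to the preimage of [k] in [O], and avoid [x]. *)
Lemma exclude_transcendental (k O : L -> Prop) x : graded_subring hom k ->
  val_ring hom O -> lsubset k O -> homogeneous hom x -> O x -> ~ algebraic_mod k O x ->
  exists O2, [/\ val_ring hom O2, lsubset O2 O, lsubset k O2 & ~ O2 x].
Proof.
move=> hk hO kO hx Ox nalg; have gO := proj1 hO.
have x0 : x != 0.
  apply: contra_notN nalg => /eqP ->; exists 'X; rewrite monicX size_polyX hornerX.
  split=> //; last by left.
  by move=> i; rewrite coefX; case: eqP => _; [apply: (gsub1 hk)|apply: (gsub0 hk)].
have ux := homog_unit hL hx x0.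
pose R0 y := exists2 c, k c & max_ideal O (y - c).
have gR0 : graded_subring hom R0 by apply: gsub_add_max_ideal.
have hV := homogV hL hx; have gR := gsub_adjoin hL gR0 hV.
have R0R := @adjoin_sub _ _ _ R0 x^-1 gR0.
have mR0 : lsubset (max_ideal O) R0.
  by move=> y my; exists 0; [apply: (gsub0 hk)|rewrite subr0].
have kR0 : lsubset k R0 by move=> y ky; exists y; rewrite // subrr; left.
have nRx : ~ adjoin R0 x^-1 x.
  move=> [p [hp e]]; have /choice[c hc] : forall i, exists c, k c /\ max_ideal O (p`_i - c).
    by move=> i; have [c kc mc] := hp i; exists c.
  (* Multiplying [x = p(x^-1)] by [x^n] and replacing each coefficient by the congruent [c i] in [k]
     gives a monic [q] of degree [n + 1] with [q(x)] in the maximal ideal. *)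
  apply: nalg; pose n := size p; pose r := \sum_(i < n) c i *: 'X^(n - i).
  have sr : (size r <= n.+1)%N.
    apply: leq_trans (size_sum _ _ _) _; apply/bigmax_leqP => i _.
    by apply: leq_trans (size_scale_leq _ _) _; rewrite size_polyXn ltnS leq_subr.
  pose q : {poly L} := 'X^(n.+1) - r.
  have sq : size q = n.+2.
    by rewrite size_polyDl ?size_polyXn // size_polyN ltnS.
  exists q; split; rewrite ?sq //.
  - by rewrite monicE lead_coefDl ?lead_coefXn // size_polyN size_polyXn ltnS.
  - move=> i; rewrite coefB coefXn coef_sum; apply: (gsubB hk).
      by case: eqP => _; [apply: (gsub1 hk)|apply: (gsub0 hk)].
    apply: (gsub_sum hk) => j _; rewrite coefZ coefXn; apply: (gsubM hk); first by case: (hc j).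
    by case: eqP => _; [apply: (gsub1 hk)|apply: (gsub0 hk)].
  have -> : q.[x] = \sum_(i < n) (p`_i - c i) * x ^+ (n - i).
    rewrite hornerD hornerN hornerXn horner_sum exprS {1}e horner_coef mulr_suml -sumrB.
    apply: eq_bigr => i _; rewrite hornerZ hornerXn mulrBl; congr (_ - _).
    rewrite -mulrA; congr (_ * _); rewrite exprB ?(ltnW (ltn_ord i)) //.
    by rewrite mulrC exprVn.
  apply: (max_ideal_sum hL hO) => i _; rewrite mulrC; apply: (max_idealMl hO).
    exact: (gsubX gO).
  by case: (hc i).
have [||O2 [hO2 RO2 nx]] := @exists_val_ring _ _ _ hL _ (fun y => y = x) gR.
- by move=> _ ->; split=> //; apply: (adjoin_gen _ gR0).
- by move=> _ _ -> ->; left; rewrite divrr //; apply: (gsub1 gR).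
exists O2; split=> //; last exact: nx; last by move=> y ky; apply/RO2/R0R/kR0.
(* A homogeneous [y] in [O2] outside [O] would have [x / y] in the maximal ideal of [O], hence in
   [O2], and then [x = (x / y) * y] would be in [O2]. *)
apply: (gsub_le hL (proj1 hO2) gO) => y hy y0 O2y; apply: contrapT => nOy.
have uy := homog_unit hL hy y0.
have my : max_ideal O y^-1 by apply: (max_ideal_homog hL hO (homogV hL hy)); rewrite invrK.
apply: (nx x) => //; rewrite -[x](divrK uy); apply: (gsubM (proj1 hO2)) => //.
by apply/RO2/R0R/mR0; apply: (max_idealMl hO).
Qed.

(** The start is [L] itself as a valuation ring. An element whose residue is not algebraic is thrown
    out by a refinement, and residues already algebraic stay so by [max_ideal_anti]. *)
Lemma exists_algebraic_residues (k : L -> Prop) (s : seq L) : graded_subring hom k ->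
  (forall x, x \in s -> homogeneous hom x) ->
  exists O, [/\ val_ring hom O, lsubset k O &
    forall x, x \in s -> O x -> algebraic_mod k O x].
Proof.
move=> hk; elim: s => [|x s IH] hs.
  by exists (fun=> True); split=> //; split=> [|f _ _]; [apply: gsub_full|left].
have [|O [hO kO H]] := IH; first by move=> y ys; apply: hs; rewrite inE ys orbT.
have hx := hs x (mem_head _ _).
have [alg|nalg] := pselect (O x -> algebraic_mod k O x).
  by exists O; split=> // y; rewrite inE => /orP[/eqP ->|/H].
have /not_implyP[Ox nalgx] := nalg.
have [O2 [hO2 le kO2 nx]] := exclude_transcendental hk hO kO hx Ox nalgx.
exists O2; split=> // y; rewrite inE => /orP[/eqP -> //|ys O2y].
have [q [mq sq kq mqx]] := H y ys (le _ O2y).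
by exists q; split=> //; apply: (max_ideal_anti hO hO2).
Qed.

(* The ring to extend consists of the quotients [p(v) / v^M] with [p] of leading monomial at most
   [M] and coefficients in the preimage of [k]; the quotients [v^N / v^M] with [M < N] are
   avoided. *)
Lemma exists_monomial_refinement (k O : L -> Prop) n (v : 'I_n.+1 -> L) :
  graded_subring hom k -> val_ring hom O -> lsubset k O ->
  (forall i, homogeneous hom (v i)) -> (forall i, O (v i)) ->
  (forall p, coefs_in k p -> max_ideal O p.@[v] -> p = 0) ->
  exists O2, [/\ val_ring hom O2, lsubset O2 O, lsubset k O2 &
    forall M N : 'X_{1..n.+1}, (M < N)%O -> ~ O2 (mon v N / mon v M)].
Proof.
move=> hk hO kO /choice[d hd] Ov ind; have gO := proj1 hO.
have v0 i : v i != 0.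
  apply/eqP => e; have : ('X_i : {mpoly L[n.+1]}) = 0.
    by apply: ind; [apply: (coefs_inX hk)|rewrite mevalXU e; left].
  move/mpolyP/(_ U_(i)%MM); rewrite mcoeffXU mcoeff0 eqxx => /eqP.
  by rewrite oner_eq0.
have um M : mon v M \is a GRing.unit by apply: (mon_unit hL hd).
have hm M : homogeneous hom (mon v M) by exists (weight d M); apply: mon_hom.
pose R0 y := exists2 c, k c & max_ideal O (y - c).
have gR0 : graded_subring hom R0 by apply: gsub_add_max_ideal.
have mR0 : lsubset (max_ideal O) R0.
  by move=> y my; exists 0; [apply: (gsub0 hk)|rewrite subr0].
have kR0 : lsubset k R0 by move=> y ky; exists y; rewrite // subrr; left.
pose lead_le (p : {mpoly L[n.+1]}) M := forall m, m \in msupp p -> (m <= M)%O.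
pose R y := exists (p : {mpoly L[n.+1]}) M,
  [/\ coefs_in R0 p, (mlead p <= M)%O & y * mon v M = p.@[v]].
have R_mon N M : (N <= M)%O -> R (mon v N / mon v M).
  move=> le; exists 'X_[N], M; split; first exact: (coefs_inX gR0).
    by rewrite mleadXm.
  by rewrite divrK // mevalX.
have leadM (p q : {mpoly L[n.+1]}) M N : (mlead p <= M)%O -> (mlead q <= N)%O ->
    (mlead (p * q) <= (M + N)%MM)%O.
  by move=> hp hq; apply: le_trans (mleadM_le _ _) (lem_add hp hq).
have gR : graded_subring hom R.
  apply: gsub_intro => //.
  - by have := R_mon 0%MM 0%MM (lexx _); rewrite mon0 invr1 mulr1.
  - move=> x y [p [M [Rp leM e]]] [q [N [Rq leN e']]].
    exists (p * 'X_[N] - q * 'X_[M]), (M + N)%MM; split.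
    + by apply: (coefs_inB gR0); apply: (coefs_inM gR0) => //; apply: (coefs_inX gR0).
    + apply: le_trans (mleadB_le _ _) _; rewrite leUx.
      rewrite leadM ?mleadXm //= [(M + N)%MM]addmC leadM ?mleadXm //.
    + rewrite mevalB !mevalM !mevalX -!/(mon v _) monD -e -e'; ring.
  - move=> x y [p [M [Rp leM e]]] [q [N [Rq leN e']]].
    exists (p * q), (M + N)%MM; split; [exact: (coefs_inM gR0)|exact: leadM|].
    by rewrite mevalM monD -e -e'; ring.
  - move=> g x [p [M [Rp leM e]]].
    exists (hpart hom d (g + weight d M) p), M; split; first exact: coefs_in_hpart.
      have [->|h0] := eqVneq (hpart hom d (g + weight d M) p) 0.
        by rewrite mlead0 le0m.
      apply: le_trans leM; apply: msupp_le_mlead.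
      have := mlead_supp h0; rewrite !mcoeff_msupp (mcoeff_hpart hL).
      by apply: contraNneq => ->; rewrite comp0.
    by rewrite (meval_hpart hL hd) -e (compMr hL _ _ (mon_hom hL hd M)) addrK.
pose X y := exists M N : 'X_{1..n.+1}, (M < N)%O /\ y = mon v N / mon v M.
have [||O2 [hO2 RO2 nX]] := @exists_val_ring _ _ _ hL R X gR.
- move=> _ [M [N [lt ->]]]; split.
  + exact: homog_div.
  + have := unitrM (mon v N) (mon v M)^-1; rewrite unitrV !um.
    by apply: contraTneq => ->; rewrite unitr0.
  + by rewrite invrM ?unitrV // invrK; apply: R_mon; apply: ltW.
  move=> [p [P [Rp leP e]]].
  have /choice[c hc] : forall m, exists c, k c /\ max_ideal O (p@_m - c).
    by move=> m; have [c kc mc] := Rp m; exists c.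
  (* With the coefficients of [p] replaced by elements of [k], the equation [v^N * v^P = p(v) * v^M]
     puts the value of ['X_[N + P] - r] in the maximal ideal, so this polynomial is zero; but every
     monomial of [r] is below [N + P]. *)
  pose r : {mpoly L[n.+1]} := \sum_(m <- msupp p) c m *: 'X_[(m + M)%MM].
  have : ('X_[(N + P)%MM] - r : {mpoly L[n.+1]}) = 0.
    apply: ind.
      apply: (coefs_inB hk); first exact: (coefs_inX hk).
      apply: (coefs_in_sum hk) => m _; apply: (coefs_inZ hk); first by case: (hc m).
      exact: (coefs_inX hk).
    have -> : ('X_[(N + P)%MM] - r).@[v] =
        \sum_(m <- msupp p) mon v (m + M)%MM * (p@_m - c m).
      rewrite mevalB mevalX -/(mon v _) (raddf_sum (meval v)) /=.
      have -> : mon v (N + P)%MM = p.@[v] * mon v M.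
        by rewrite -e monD mulrAC divrK.
      rewrite meval_mon mulr_suml -sumrB; apply: eq_bigr => m _.
      by rewrite mevalZ mevalX -/(mon v _) !monD; ring.
    apply: (max_ideal_sum hL hO) => m _; apply: (max_idealMl hO); last by case: (hc m).
    exact: (gsub_mmon gO _ Ov).
  move/mpolyP/(_ (N + P)%MM); rewrite mcoeffB mcoeffX eqxx mcoeff0 (raddf_sum (mcoeff _)) /=.
  rewrite big_seq big1 ?subr0 => [|m ms]; first by apply/eqP; rewrite oner_eq0.
  rewrite mcoeffZ mcoeffX; case: eqP => [em|_]; last by rewrite mulr0.
  have : ((m + M)%MM < (N + P)%MM)%O.
    rewrite [(N + P)%MM]addmC; apply: lemc_lt_add => //.
    exact: le_trans (msupp_le_mlead ms) leP.
  by rewrite em ltxx.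
- move=> _ _ [M [N [lt ->]]] [M' [N' [lt' ->]]].
  have E A B A' B' : mon v A / mon v B / (mon v A' / mon v B') =
      mon v (A + B')%MM / mon v (B + A')%MM.
    rewrite !monD invrM ?unitrV // invrK invrM //; ring.
  rewrite (E N M N' M') (E N' M' N M) [(N' + M)%MM]addmC [(M' + N)%MM]addmC.
  case/orP: (lemc_total (N + M')%MM (M + N')%MM) => le; [left|right].
    exact: R_mon.
  exact: R_mon.
exists O2; split=> //.
- apply: (gsub_le hL (proj1 hO2) gO) => y hy y0 O2y; apply: contrapT => nOy.
  have uy := homog_unit hL hy y0.
  have my : max_ideal O y^-1 by apply: (max_ideal_homog hL hO (homogV hL hy)); rewrite invrK.
  have mO2 : lsubset (max_ideal O) O2.
    move=> z mz; apply: RO2; exists z%:MP, 0%MM; rewrite mon0 mulr1 mevalC mleadC.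
    by split=> //; apply: (coefs_inC gR0); apply: mR0.
  (* There is at least one variable, and [v ord0] is an avoided quotient, with [M = 0]. A [y] of
     [O2] outside [O] would bring it into [O2] as [(v ord0 / y) * y]. *)
  have lt0 : ((0%MM : 'X_{1..n.+1}) < U_(@ord0 n)%MM)%O.
    rewrite lt_neqAle le0m andbT eq_sym.
    by apply/eqP => /(congr1 mdeg); rewrite mdeg1 mdeg0.
  apply: (nX (mon v U_(ord0)%MM / mon v 0%MM)); first by exists 0%MM, U_(ord0)%MM.
  rewrite -[_ / _](divrK uy); apply: (gsubM (proj1 hO2)) => //; apply: mO2.
  apply: (max_idealMl hO) => //; rewrite mon0 invr1 mulr1; exact: (gsub_mmon gO _ Ov).
- move=> y ky; apply: RO2; exists y%:MP, 0%MM; rewrite mon0 mulr1 mevalC mleadC.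
  by split=> //; apply: (coefs_inC gR0); apply: kR0.
- by move=> M N lt; apply: nX; exists M, N.
Qed.
End Residues.

(** * Surjectivity implies general position *)

Section GeneralPosition.
Variables (G : zmodType) (L : comUnitRingType) (hom : G -> L -> Prop).
Hypothesis hL : is_graded_field hom.
Notation comp := (component hom).
Notation max_ideal := (max_ideal hom).
Variables l K k : L -> Prop.
Hypotheses (hl : graded_subfield hom l) (hK : graded_subfield hom K)
  (hk : graded_subfield hom k) (hkl : lsubset k l) (hkK : lsubset k K).

Lemma graded_val_ring_trace (O : L -> Prop) : val_ring hom O -> lsubset k O ->
  graded_val_ring hom K k (psi K O).
Proof.
move=> hO kO; have [gK KV] := hK; split.
- by move=> x [].
- exact: (gsub_capI hL (proj1 hO) gK).
- by move=> x kx; split; [apply: kO|apply: hkK].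
- move=> f Kf hf f0; case: hO => _ /(_ f hf f0) [Of|Of]; [left|right]; split=> //.
  exact: KV.
Qed.

(** Divide by a dominant term [f j]: if the other quotients all lay in the maximal ideal, so would
    [1]. *)
Lemma two_dominant_terms (O : L -> Prop) (I : eqType) (s : seq I) (f : I -> L) i1 :
  val_ring hom O -> uniq s -> (forall i, homogeneous hom (f i)) -> i1 \in s -> f i1 != 0 ->
  \sum_(i <- s) f i = 0 ->
  exists i j, [/\ i \in s, j \in s, i != j, f i != 0 & f j != 0] /\
    (O (f i / f j) /\ O (f j / f i)).
Proof.
move=> hO us hf i1s f1 e; have gO := proj1 hO.
have [j [js fj H]] := val_ring_dominant hL hO hf i1s f1.
have uj := homog_unit hL (hf j) fj.
have [i [is_ ne nm]] : exists i, [/\ i \in s, i != j & ~ max_ideal O (f i / f j)].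
  apply: contrapT => no; apply: (max_ideal1 hO).
  have -> : 1 = - \sum_(i <- s | i != j) f i / f j.
    rewrite -mulr_suml; apply/eqP; rewrite -addr_eq0 -[1](divrr uj) -mulrDl.
    by rewrite -(bigD1_seq j) //= e mul0r.
  apply: (max_idealN hO); rewrite big_seq_cond; apply: (max_ideal_sum hL hO) => i /andP[is_ ne].
  by apply: contrapT => nm; apply: no; exists i.
have fi : f i != 0.
  by apply: contra_notN nm => /eqP ->; rewrite mul0r; left.
have ui := homog_unit hL (hf i) fi.
exists i, j; split=> //; split; first exact: H.
have -> : f j / f i = (f i / f j)^-1 by rewrite invrM ?unitrV // invrK.
apply: contrapT => nO; apply: nm.
exact: (max_ideal_homog hL hO (homog_div hL (hf i) (hf j))).
Qed.

Hypothesis surj : forall O', graded_val_ring hom K k O' ->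
  exists O, [/\ val_ring hom O, lsubset l O & lseteq (psi K O) O'].

Lemma surjective_general_position : general_position hom k l K.
Proof.
have [gl lV] := hl; have [gK KV] := hK; have [gk _] := hk.
move=> n v _ hv indk; apply: contrapT => nindK.
(* The refinement needs at least one variable; the empty family is independent over anything. *)
case: n v hv indk nindK => [|n] v hv indk nindK; first exact/nindK/alg_indep_empty.
have lv i : l (v i) by case: (hv i).
have hhv i : homogeneous hom (v i) by case: (hv i).
have v0 i : v i != 0 by case: (hv i).
have /choice[d hd] : forall i, exists g, hom g (v i) by [].
have [p [g [p0 Kp pv hp]]] := homog_relation hL hd gK nindK.
have hpm m : homogeneous hom p@_m by exists (g - weight d m).
have um M : mon v M \is a GRing.unit by apply: (mon_unit hL hd).
have hm M : homogeneous hom (mon v M) by exists (weight d M); apply: mon_hom.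
pose s := [seq p@_a / p@_b | a <- msupp p, b <- msupp p].
have [|O1 [hO1 kO1 alg]] := @exists_algebraic_residues _ _ _ hL k s gk.
  by move=> _ /allpairsP[[a b] [_ _ ->]]; apply: homog_div.
have [O [hO lO eO]] := surj (graded_val_ring_trace hO1 kO1).
have kO : lsubset k O by move=> y /hkl /lO.
have Ov i : O (v i) by apply: lO.
have OmV M : O (mon v M)^-1.
  apply/lO/lV => //; first exact: (gsub_mmon gl _ lv).
  by apply: contraTneq (um M) => ->; rewrite unitr0.
have Om M : O (mon v M) by exact: (gsub_mmon (proj1 hO) _ Ov).
(* The value at [v] of a polynomial over [k] is in [l], whose nonzero homogeneous elements are units
   of [O]; a value in the maximal ideal is therefore zero. *)
have [|O2 [hO2 le kO2 nO2]] := exists_monomial_refinement hL gk hO kO hhv Ov.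
  move=> q kq mq; apply: indk => //; apply: (comp_eq0 hL) => h; apply/eqP.
  apply: contrapT => /negP c0; have hc := comp_homog hL h q.@[v].
  apply: (max_ideal_unit hO (homog_unit hL hc c0)); last exact: max_ideal_comp.
  apply/lO/lV => //; apply: gsub_comp => //; apply: (gsub_meval gl) => // m; exact/hkl/kq.
have gO2 := proj1 hO2.
have [i [j [[is_ js ne fi fj] [Oij Oji]]]] : exists i j,
    [/\ i \in msupp p, j \in msupp p, i != j, p@_i * mon v i != 0 & p@_j * mon v j != 0] /\
    (O2 (p@_i * mon v i / (p@_j * mon v j)) /\ O2 (p@_j * mon v j / (p@_i * mon v i))).
  apply: (two_dominant_terms (f := fun m => p@_m * mon v m) hO2 _ _ (mlead_supp p0)).
  - exact: msupp_uniq.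
  - by move=> m; apply: homogM.
  - apply: (homogM_neq0 hL) => //; first by rewrite mleadc_eq0.
    by apply: contraTneq (um (mlead p)) => ->; rewrite unitr0.
  - by rewrite -meval_mon.
have uc m : m \in msupp p -> p@_m \is a GRing.unit.
  by rewrite mcoeff_msupp; apply: (homog_unit hL).
have quotE a b : a \in msupp p -> b \in msupp p ->
    p@_a * mon v a / (p@_b * mon v b) = p@_a / p@_b * (mon v a / mon v b).
  by move=> as_ bs; rewrite invrM ?uc //; ring.
(* The monomials are units of [O], so the quotient [c] of coefficients lies in [O] and [K], hence in
   [O1], where [q(c)] is in the maximal ideal for some monic [q] over [k]. A component of [q(c)]
   outside [O2] would have its inverse in [O] and [K], hence in [O1], which is impossible; so
   [q(c)], and with it [c], lies in [O2]. *)
have coef_in a b : a \in msupp p -> b \in msupp p ->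
    O2 (p@_a * mon v a / (p@_b * mon v b)) -> O2 (p@_a / p@_b).
  move=> as_ bs /le; rewrite quotE // => Oab.
  have Kc : K (p@_a / p@_b).
    by apply: (gsubM gK) => //; apply: KV => //; rewrite -mcoeff_msupp.
  have Oc : O (p@_a / p@_b).
    have -> : p@_a / p@_b = p@_a / p@_b * (mon v a / mon v b) * (mon v b * (mon v a)^-1).
      by rewrite -[LHS]mulr1 -[RHS]mulrA; congr (_ * _); rewrite mulrA divrK // divrr.
    by apply: (gsubM (proj1 hO)) => //; apply: (gsubM (proj1 hO)).
  have [O1c _] := proj1 (eO _) (conj Oc Kc).
  have sc : p@_a / p@_b \in s by apply/allpairsP; exists (a, b).
  have [q [mq sq kq mqx]] := alg _ sc O1c.
  apply: (val_ring_monic hL hO2 _ mq sq) => //; [exact: homog_div|by move=> t; apply: kO2|].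
  have Kq : K q.[p@_a / p@_b] by apply: (gsub_horner gK) => // t; apply/hkK/kq.
  have [r ->] := comp_decomp hL q.[p@_a / p@_b]; apply: (gsub_sum gO2) => h _.
  set y := comp h _; have hy : homogeneous hom y by apply: comp_homog.
  have Ky : K y by apply: gsub_comp.
  have [->|y0] := eqVneq y 0; first exact: (gsub0 gO2).
  apply: contrapT => /(val_ring_notin hO2 hy) /le OyV.
  have [O1yV _] := proj1 (eO _) (conj OyV (KV _ Ky hy y0)).
  apply: (max_ideal_unit hO1 (homog_unit hL hy y0) O1yV); exact: max_ideal_comp.
have mon_in a b : a \in msupp p -> b \in msupp p ->
    O2 (p@_a * mon v a / (p@_b * mon v b)) -> O2 (p@_b * mon v b / (p@_a * mon v a)) ->
    O2 (mon v a / mon v b).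
  move=> as_ bs Oab Oba; have -> : mon v a / mon v b =
      p@_a * mon v a / (p@_b * mon v b) * (p@_b / p@_a).
    rewrite quotE // mulrAC [p@_a / _ * _]mulrA divrK ?uc // divrr ?uc // mul1r //.
  by apply: (gsubM gO2) => //; apply: coef_in.
(* Both quotients of the two monomials lie in [O2], whereas [O2] omits the larger over the
   smaller. *)
have : (i < j)%O || (j < i)%O by case: ltgtP ne.
by case/orP => /nO2; apply; apply: mon_in.
Qed.
End GeneralPosition.

(** * Finite fibers *)

(** A family of pairwise distinct members of the largest possible size cannot be extended, so it
    meets every class; the induction on [N] finds that size. *)
Lemma bounded_family_cover (T : comUnitRingType) (P : (T -> Prop) -> Prop) N :
  (forall F : 'I_N -> (T -> Prop), (forall i, P (F i)) ->
     (forall i j, i != j -> ~ lseteq (F i) (F j)) -> False) ->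
  exists n (F : 'I_n -> (T -> Prop)), forall O, P O -> exists i, lseteq O (F i).
Proof.
elim: N => [|N IH] H; first by case: (H (fun _ _ => True)) => -[].
have [[F [PF dF]]|no] := pselect (exists F : 'I_N -> (T -> Prop),
    (forall i, P (F i)) /\ (forall i j, i != j -> ~ lseteq (F i) (F j))); last first.
  by apply: IH => F PF dF; apply: no; exists F.
exists N, F => O PO; apply: contrapT => no; apply: (H (extend_family F O)).
  by move=> i; rewrite /extend_family; case: unliftP.
move=> i j; rewrite /extend_family.
case: (unliftP ord_max i) => [i' ->|->]; case: (unliftP ord_max j) => [j' ->|->] ne e.
- by apply: (dF i' j' _ e); apply: contraNneq ne => ->.
- by apply: no; exists i' => x; split=> /e.
- by apply: no; exists j'.
- by rewrite eqxx in ne.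
Qed.

Section FiniteFibers.
Variables (G : zmodType) (L : comUnitRingType) (hom : G -> L -> Prop).
Hypothesis hL : is_graded_field hom.
Notation comp := (component hom).
Notation max_ideal := (max_ideal hom).

(** * Linear dependence over a graded subfield *)

Section Dependence.
Variable K : L -> Prop.
Hypothesis hK : graded_subfield hom K.
Let gK : graded_subring hom K. Proof. by case: hK. Qed.

(* Gaussian elimination of the last generator. *)
Lemma homog_dependence n : forall (e : 'I_n -> L) (de : 'I_n -> G) (w : 'I_n.+1 -> L)
    (dw : 'I_n.+1 -> G) (c : 'I_n.+1 -> 'I_n -> L),
  (forall i j, K (c i j) /\ hom (dw i - de j) (c i j)) ->
  (forall i, w i = \sum_j c i j * e j) ->
  exists (h : G) (a : 'I_n.+1 -> L), [/\ forall i, K (a i) /\ hom (h - dw i) (a i),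
    exists i, a i != 0 & \sum_i a i * w i = 0].
Proof.
elim: n => [|n IH] e de w dw c hc ew.
  exists (dw ord0), (fun=> 1); split.
  - move=> i; rewrite (ord1 i) subrr; split; [exact: (gsub1 gK)|exact: hom1].
  - by exists ord0; apply: oner_neq0.
  - by rewrite big_ord1 ew big_ord0 mulr0.
(* If the last column vanishes, any row serves as pivot, since the quotients [q i] are then 0. *)
have [i0 hi0] : exists i0, forall i, c i ord_max != 0 -> c i0 ord_max != 0.
  have [[i ni]|no] := pselect (exists i, c i ord_max != 0); first by exists i.
  by exists ord0 => i ni; case: no; exists i.
pose q i := c i ord_max / c i0 ord_max.
have hq i : [/\ K (q i), hom (dw i - dw i0) (q i) & q i * c i0 ord_max = c i ord_max].
  have [c0|c0] := eqVneq (c i ord_max) 0.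
    rewrite /q c0 !mul0r; split=> //; [exact: (gsub0 gK)|exact: hom0].
  have hcm : homogeneous hom (c i0 ord_max) by eexists; apply: (hc i0 ord_max).2.
  split; last by rewrite divrK // (homog_unit hL hcm) // (hi0 i).
    apply: (gsubM gK); first exact: (hc _ _).1.
    by case: hK => _; apply=> //; [exact: (hc _ _).1|exact: hi0 c0].
  have := homM hL (hc i ord_max).2 (homV hL (hc i0 ord_max).2).
  by rewrite opprB addrA subrK.
pose W j := widen_ord (leqnSn n) j.
pose w' i := w (lift i0 i) - q (lift i0 i) * w i0.
pose c' i j := c (lift i0 i) (W j) - q (lift i0 i) * c i0 (W j).
have [|| h [a [ha [i1 ai1] ea]]] :=
    IH (fun j => e (W j)) (fun j => de (W j)) w' (fun i => dw (lift i0 i)) c'.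
- move=> i j; have [Kq hqi _] := hq (lift i0 i); split.
    by apply: (gsubB gK); [exact: (hc _ _).1|apply: (gsubM gK) => //; exact: (hc _ _).1].
  apply: homB => //; first exact: (hc _ _).2.
  by have := homM hL hqi (hc i0 (W j)).2; rewrite addrA subrK.
- move=> i; have [_ _ eq] := hq (lift i0 i).
  rewrite /w' !ew !big_ord_recr /= mulrDr (mulrA (q _) _ (e _)) eq opprD addrACA subrr addr0.
  rewrite mulr_sumr -sumrB.
  by apply: eq_bigr => j _; rewrite mulrBl mulrA.
pose b i := if unlift i0 i is Some i' then a i' else - \sum_i' a i' * q (lift i0 i').
have b0 : b i0 = - \sum_i' a i' * q (lift i0 i') by rewrite /b unlift_none.
have bl i : b (lift i0 i) = a i by rewrite /b liftK.
exists h, b; split.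
- move=> i; case: (unliftP i0 i) => [i' ->|->]; first by rewrite bl.
  rewrite b0; split.
    apply: (gsubN gK); apply: (gsub_sum gK) => j _; apply: (gsubM gK); first exact: (ha j).1.
    by have [] := hq (lift i0 j).
  apply: homN => //; apply: hom_sum => // j _; have [_ hqj _] := hq (lift i0 j).
  by have := homM hL (ha j).2 hqj; rewrite /= addrA subrK.
- by exists (lift i0 i1); rewrite bl.
- rewrite (bigD1_ord i0) //= b0 mulNr mulr_suml addrC -sumrB -[RHS]ea.
  by apply: eq_bigr => i _; rewrite bl /w' mulrBr [X in _ = _ - X]mulrA.
Qed.

Hypothesis fK : finite_ext hom K.

Lemma finite_ext_dependence : exists n, forall (w : 'I_n.+1 -> L) (dw : 'I_n.+1 -> G),
  (forall i, hom (dw i) (w i)) ->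
  exists (h : G) (a : 'I_n.+1 -> L), [/\ forall i, K (a i) /\ hom (h - dw i) (a i),
    exists i, a i != 0 & \sum_i a i * w i = 0].
Proof.
have [n [e [/choice[de hde] _ span]]] := fK; exists n => w dw hw.
have /choice[c hc] : forall i, exists c : 'I_n -> L,
    (forall j, K (c j)) /\ w i = \sum_j c j * e j by move=> i; apply: span.
(* Keeping the component of degree [dw i - de j] makes the coefficients homogeneous without changing
   [w i]. *)
apply: (homog_dependence (e := e) (de := de) (c := fun i j => comp (dw i - de j) (c i j))).
  by move=> i j; split; [apply: gsub_comp => //; apply: (hc i).1|apply: comp_hom].
move=> i; rewrite -[LHS](comp_id hL (hw i)) {1}(hc i).2 comp_sum //.
by apply: eq_bigr => j _; rewrite (compMr hL _ _ (hde j)).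
Qed.

(** Powers of [y] are linearly dependent over [K]. Two dominant terms of a homogeneous relation
    between them have the same degree and value, so their quotient is the degree-0 unit [t]. *)
Lemma power_in_base (O : L -> Prop) y : val_ring hom O -> homogeneous hom y -> y != 0 ->
  exists n c t, [/\ (0 < n)%N, K c, y ^+ n = t * c & [/\ hom 0 t, O t & O t^-1]].
Proof.
move=> hO [g hy] y0; have [N dep] := finite_ext_dependence.
have uy : y \is a GRing.unit by apply: (homog_unit hL) => //; exists g.
have [h [a [ha [i1 ai1] ea]]] := dep (fun i => y ^+ i) (fun i => g *+ i) (fun i => homX hL i hy).
have hha i : homogeneous hom (a i) by exists (h - g *+ i); case: (ha i).
pose f i := a i * y ^+ (nat_of_ord i).
have [||||| i [j [[_ _ ne fi fj] [Oij Oji]]]] := @two_dominant_terms _ _ _ hL O _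
    (index_enum 'I_N.+1) f i1 hO.
- exact: index_enum_uniq.
- by move=> i; apply: homogM => //; exists (g *+ i); apply: homX.
- exact: mem_index_enum.
- by apply: (homogM_neq0 hL) => //; apply: contraTneq (unitrX i1 uy) => ->; rewrite unitr0.
- exact: ea.
wlog lt : i j ne fi fj Oij Oji / (j < i)%N.
  move=> H; case: (ltngtP j i) => [lt|lt|e].
  - exact: (H i j).
  - by apply: (H j i) => //; rewrite eq_sym.
  - by rewrite (ord_inj e) eqxx in ne.
have a0 m : f m != 0 -> a m != 0 by apply: contraNneq => e; rewrite /f e mul0r.
have ui := homog_unit hL (hha i) (a0 _ fi); have uj := homog_unit hL (hha j) (a0 _ fj).
have ufi : f i \is a GRing.unit by rewrite /f unitrM ui unitrX.
have ufj : f j \is a GRing.unit by rewrite /f unitrM uj unitrX.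
exists (i - j)%N, (a j / a i), (f i / f j); split.
- by rewrite subn_gt0.
- by case: hK => _ KV; apply: (gsubM gK); [case: (ha j)|apply: KV => //; [case: (ha i)|apply: a0]].
- rewrite exprB 1?ltnW // /f invrM ?unitrX //.
  rewrite [RHS](_ : _ = y ^+ i / y ^+ j * (a i / a i) * (a j / a j)); last by ring.
  by rewrite !divrr // !mulr1.
split=> //; last by rewrite invrM ?unitrV // invrK.
have hf m : hom h (f m) by have := homM hL (ha m).2 (homX hL m hy); rewrite subrK.
by have := homM hL (hf i) (homV hL (hf j)); rewrite subrr.
Qed.

(* A power of each homogeneous element is a degree-0 unit times an element of [K]. *)
Lemma val_ring_eq_degree0 (O1 O2 : L -> Prop) : val_ring hom O1 -> val_ring hom O2 ->
  lseteq (psi K O1) (psi K O2) -> (forall x, hom 0 x -> O1 x -> O2 x) -> lseteq O1 O2.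
Proof.
move=> hO1 hO2 e le; have g1 := proj1 hO1; have g2 := proj1 hO2.
suff H y : homogeneous hom y -> y != 0 -> (O1 y <-> O2 y).
  by split; [apply: (gsub_le hL g1 g2)|apply: (gsub_le hL g2 g1)] => y hy y0 /(H y hy y0).
move=> hy y0; have [n [c [t [n0 Kc ey [t0 O1t O1tV]]]]] := power_in_base hO1 hy y0.
(* Both [t] and its inverse pass to [O2], which is why an inclusion in one direction is enough. *)
have O2t := le _ t0 O1t; have O2tV : O2 t^-1.
  by apply: le => //; have := homV hL t0; rewrite oppr0.
have ut : t \is a GRing.unit.
  apply: (homog_unit hL); first by exists 0.
  apply: contraTneq (unitrX n (homog_unit hL hy y0)) => t00.
  by rewrite ey t00 mul0r unitr0.
have ec : c = y ^+ n * t^-1 by rewrite ey mulrAC divrr // mul1r.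
split=> Oy.
  apply: (val_ring_expn hL hO2 hy n0); rewrite ey; apply: (gsubM g2) => //.
  apply: (proj1 (proj1 (e c) _)); split=> //; rewrite ec; apply: (gsubM g1) => //.
  exact: (gsubX g1).
apply: (val_ring_expn hL hO1 hy n0); rewrite ey; apply: (gsubM g1) => //.
apply: (proj1 (proj2 (e c) _)); split=> //; rewrite ec; apply: (gsubM g2) => //.
exact: (gsubX g2).
Qed.
End Dependence.

(** * Separating valuation rings in degree 0 *)

Section Separation.
Definition geom (x : L) n : L := \sum_(i < n) x ^+ i.

Lemma geomD x m n : geom x (m + n) = geom x m + x ^+ m * geom x n.
Proof.
rewrite /geom big_split_ord /= mulr_sumr; congr (_ + _).
by apply: eq_bigr => i _; rewrite exprD.
Qed.

Lemma geom1 x : geom x 1 = 1. Proof. by rewrite /geom big_ord1 expr0. Qed.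

Lemma geomS x n : geom x n.+1 = 1 + x * geom x n.
Proof. by rewrite -add1n geomD geom1 expr1. Qed.

Lemma geomV x n : x \is a GRing.unit -> geom x n.+1 = x ^+ n * geom x^-1 n.+1.
Proof.
move=> ux; rewrite /geom mulr_sumr (reindex_inj rev_ord_inj) /=; apply: eq_bigr => i _.
by rewrite subSS exprB ?exprVn // -ltnS.
Qed.

Lemma geom_hom0 x n : hom 0 x -> hom 0 (geom x n).
Proof. by move=> hx; apply: hom_sum => // i _; have := homX hL i hx; rewrite mul0rn. Qed.

(** If some [geom x d] lies in the maximal ideal, so does each [geom x (m * d)], and one further
    term makes the sum congruent to 1; otherwise [d = 1] works. Multiplying the periods then treats
    several rings at once. *)
Lemma geom_unit_period (O : L -> Prop) x : val_ring hom O -> O x ->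
  exists2 d, (0 < d)%N & forall m, ~ max_ideal O (geom x (m * d).+1).
Proof.
move=> hO Ox; have [[d d0 md]|no] := pselect (exists2 d, (0 < d)%N & max_ideal O (geom x d));
    last by exists 1%N => // m mm; apply: no; exists (m * 1).+1.
have mulD m : max_ideal O (geom x (m * d)).
  elim: m => [|m IH]; first by rewrite mul0n /geom big_ord0; left.
  rewrite mulSn geomD; apply: (max_idealD hL hO) => //; apply: (max_idealMl hO) => //.
  exact: (gsubX (proj1 hO)).
exists d => // m; rewrite geomS => mm; apply: (max_ideal1 hO).
rewrite -[1](addrK (x * geom x (m * d))); apply: (max_idealB hL hO) => //.
exact: (max_idealMl hO).
Qed.

(* [t = 1 / (1 + z + ... + z^(N-1))] for a suitable [N]. *)
Lemma exists_truncation m (O : 'I_m -> (L -> Prop)) z : (forall i, val_ring hom (O i)) ->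
  hom 0 z -> exists t, hom 0 t /\ forall i,
    (O i z -> [/\ t \is a GRing.unit, O i t & O i t^-1]) /\ (~ O i z -> max_ideal (O i) t).
Proof.
move=> hO hz; have hhz : homogeneous hom z by exists 0.
have /choice[d hd] : forall i, exists d, (0 < d)%N /\
    (O i z -> forall m, ~ max_ideal (O i) (geom z (m * d).+1)).
  move=> i; have [Oz|nz] := pselect (O i z); last by exists 1%N.
  by have [d d0 H] := geom_unit_period (hO i) Oz; exists d.
pose N := (\prod_i d i)%N.
have N0 : (0 < N)%N by apply: prodn_gt0 => i; case: (hd i).
have h0 := geom_hom0 N.+1 hz; have hh : homogeneous hom (geom z N.+1) by exists 0.
exists (geom z N.+1)^-1; split; first by have := homV hL h0; rewrite oppr0.
move=> i; have gi := proj1 (hO i); split.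
  move=> Oz; have nm : ~ max_ideal (O i) (geom z N.+1).
    have [_ /(_ Oz (N %/ d i)%N)] := hd i; rewrite divnK //.
    by rewrite /N (bigD1 i) //= dvdn_mulr.
  rewrite unitrV invrK; split.
  - by apply: (homog_unit hL hh); apply: contra_notN nm => /eqP ->; left.
  - by apply: contrapT => nO; apply: nm; apply: (max_ideal_homog hL (hO i)).
  - by apply: (gsub_sum gi) => j _; apply: (gsubX gi).
move=> nz; have uz := homog_unit hL hhz (val_ring_notin_neq0 (hO i) nz).
have OzV := val_ring_notin (hO i) hhz nz.
have mzV : max_ideal (O i) z^-1.
  by apply: (max_ideal_homog hL (hO i) (homogV hL hhz)); rewrite invrK.
have hzV : hom 0 z^-1 by have := homV hL hz; rewrite oppr0.
(* Here the sum is [z ^+ N * u] with [u] congruent to 1; as [N] is positive, its inverse is in the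
   maximal ideal. *)
set u := geom z^-1 N.+1; have hu : homogeneous hom u.
  by exists 0; apply: geom_hom0.
have nmu : ~ max_ideal (O i) u.
  rewrite /u geomS => mu; apply: (max_ideal1 (hO i)).
  rewrite -[1](addrK (z^-1 * geom z^-1 N)); apply: (max_idealB hL (hO i)) => //.
  rewrite mulrC; apply: (max_idealMl (hO i)) => //.
  by apply: (gsub_sum gi) => j _; apply: (gsubX gi).
have u0 : u != 0 by apply: contra_notN nmu => /eqP ->; left.
have uu := homog_unit hL hu u0.
rewrite geomV // -/u invrM ?unitrX // -exprVn; apply: (max_idealMl (hO i)).
  by apply: contrapT => nO; apply: nmu; apply: (max_ideal_homog hL (hO i)).
rewrite -(prednK N0) exprSr; apply: (max_idealMl (hO i)) => //.
exact: (gsubX gi).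
Qed.

(** The unit is the product, over [j], of truncations of elements that separate [O i] from [O j]. *)
Lemma exists_separating_unit m (O : 'I_m -> (L -> Prop)) i :
  (forall i, val_ring hom (O i)) ->
  (forall j, j != i -> exists z, [/\ hom 0 z, O i z & ~ O j z]) ->
  exists u, [/\ hom 0 u, u \is a GRing.unit, O i u^-1 & forall j, j != i -> max_ideal (O j) u].
Proof.
move=> hO sep; have gi := proj1 (hO i).
have /choice[t ht] : forall j, exists t, [/\ hom 0 t, t \is a GRing.unit /\ O i t^-1,
    forall b, O b t & j != i -> max_ideal (O j) t].
  move=> j; have [->|ne] := eqVneq j i.
    exists 1; split=> //; rewrite ?invr1 ?unitr1; [exact: hom1|by split=> //; apply: (gsub1 gi)|].
    by move=> b; apply: (gsub1 (proj1 (hO b))).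
  have [z [hz Oz nz]] := sep j ne; have [t [h0 H]] := exists_truncation hO hz.
  exists t; split=> //; first by case: ((H i).1 Oz).
    move=> b; have [/(H b).1[]//|/(H b).2] := pselect (O b z).
    exact: (max_ideal_sub hL (hO b)).
  by move=> _; apply: (H j).2.
have [ut OV] : \prod_j t j \is a GRing.unit /\ O i (\prod_j t j)^-1.
  apply: (big_ind (fun x => x \is a GRing.unit /\ O i x^-1)) => [|x y [ux Ox] [uy Oy]|j _];
    last by case: (ht j).
    by rewrite unitr1 invr1; split=> //; apply: (gsub1 gi).
  by rewrite unitrM ux uy invrM //; split=> //; apply: (gsubM gi).
exists (\prod_j t j); split=> //.
  have := hom_prod hL (f := fun=> 0) (F := t) (index_enum 'I_m).
  by rewrite big1 //; apply=> j; case: (ht j).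
move=> j ne; rewrite (bigD1 j) //= mulrC; apply: (max_idealMl (hO j)).
  by apply: (gsub_prod (proj1 (hO j))) => b _; have [_ _ H _] := ht b.
by have [_ _ _] := ht j; apply.
Qed.
End Separation.

(** For [N + 1] distinct rings over [O'], take the separating units [u i] and a relation between
    them over [K]. Divided by a dominant coefficient [a i0], its coefficients lie in [O'], hence in
    every [F i]; this puts [u i0] in the maximal ideal of [F i0], which contains its inverse. *)
Lemma finite_fibers (K k O' : L -> Prop) : graded_subfield hom K -> finite_ext hom K ->
  graded_val_ring hom K k O' -> exists n (F : 'I_n -> (L -> Prop)), forall O,
    val_ring hom O /\ lseteq (psi K O) O' -> exists i, lseteq O (F i).
Proof.
move=> hK fK hO'; have gK := proj1 hK.
have [N dep] := finite_ext_dependence hK fK.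
apply: (@bounded_family_cover _ _ N.+1) => F PF dF.
have hF i : val_ring hom (F i) by case: (PF i).
have eF i x : K x -> F i x <-> O' x.
  by case: (PF i) => _ e Kx; split=> [Fx|/e[]//]; apply/e.
have /choice[u hu] : forall i, exists u, [/\ hom 0 u, u \is a GRing.unit, F i u^-1 &
    forall j, j != i -> max_ideal (F j) u].
  (* By [val_ring_eq_degree0], even an inclusion between degree-0 parts would make two rings of the
     fiber equal. *)
  move=> i; apply: exists_separating_unit => // j ne; apply: contrapT => no.
  apply: (dF i j); first by rewrite eq_sym.
  apply: (val_ring_eq_degree0 hK fK) => //.
    by have [_ ei] := PF i; have [_ ej] := PF j => x; split=> [/ei /ej|/ej /ei].
  by move=> x hx Fx; apply: contrapT => nx; apply: no; exists x.
have [h [a [ha [i1 ai1] ea]]] := dep u (fun=> 0) (fun i => let: And4 h _ _ _ := hu i in h).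
have hha i : homogeneous hom (a i) by exists (h - 0); case: (ha i).
have [i0 [_ ai0 dom]] :=
  val_ring_dominant hL (hF i1) hha (mem_index_enum i1) ai1.
have u0 := homog_unit hL (hha i0) ai0.
have [hu0 uu FuV _] := hu i0.
apply: (max_ideal_unit (hF i0) uu FuV).
have -> : u i0 = - \sum_(i | i != i0) a i / a i0 * u i.
  have e : u i0 + \sum_(i | i != i0) a i / a i0 * u i = (a i0)^-1 * \sum_i a i * u i.
    rewrite mulr_sumr [RHS](bigD1 i0) //= mulKr //; congr (_ + _).
    by apply: eq_bigr => i _; rewrite mulrA [a i / _]mulrC.
  by apply/eqP; rewrite -addr_eq0 e ea mulr0.
apply: (max_idealN (hF i0)); apply: (max_ideal_sum hL (hF i0)) => i ne.
have [_ _ _ mu] := hu i; apply: (max_idealMl (hF i0)); last by apply: mu; rewrite eq_sym.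
have Kq : K (a i / a i0).
  apply: (gsubM gK); first by case: (ha i).
  by case: hK => _; apply=> //; case: (ha i0).
by apply/(eF i0 _ Kq); apply/(eF i1 _ Kq); apply: dom; apply: mem_index_enum.
Qed.
End FiniteFibers.

(** * The bijective case *)

Section Bijectivity.
Variables (G : zmodType) (L : comUnitRingType) (hom : G -> L -> Prop).
Hypothesis hL : is_graded_field hom.

Lemma graded_val_ring_full (l O : L -> Prop) :
  graded_val_ring hom (fun _ => True) l O <-> val_ring hom O /\ lsubset l O.
Proof.
split=> [[_ gO lO H]|[[gO H] lO]]; first by split=> //; split=> // f; apply: H.
by split=> // f _; apply: H.
Qed.

(** No nonempty family in [l] is independent over [k]: the monic equation of one member is a nonzero
    relation in the variable [ord0]. *)
Lemma algebraic_general_position (k l K : L -> Prop) : graded_subring hom k ->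
  algebraic_ext k l -> general_position hom k l K.
Proof.
move=> hk alg [|n] v _ hv ind; first exact: alg_indep_empty.
have [lv _ _] := hv ord0; have [p [mp kp rp]] := alg _ lv.
pose P : {mpoly L[n.+1]} := \sum_(i < size p) p`_i *: 'X_ord0 ^+ i.
have P0 : P = 0.
  apply: ind.
    apply: (coefs_in_sum hk) => i _; apply: (coefs_inZ hk) => //.
    by rewrite mpolyXn; apply: (coefs_inX hk).
  rewrite (raddf_sum (meval v)) -[RHS](rootP rp) horner_coef; apply: eq_bigr => i _ /=.
  by rewrite mevalZ rmorphXn /= mevalXU.
have sp : ((size p).-1 < size p)%N by rewrite ltn_predL size_poly_gt0 monic_neq0.
move/mpolyP/(_ (U_(ord0) *+ (size p).-1)%MM): P0.
rewrite mcoeff0 (raddf_sum (mcoeff _)) /= (bigD1 (Ordinal sp)) //= big1 => [|i ne].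
  by rewrite addr0 mcoeffZ mcoeffXn eqxx -lead_coefE (monicP mp) mulr1 => /eqP; rewrite oner_eq0.
rewrite mcoeffZ mcoeffXn; case: eqP => [/mnmP/(_ ord0)|_]; last by rewrite mulr0.
rewrite !mulmnE !mnm1E eqxx !mul1n => e; case/eqP: ne; exact: val_inj.
Qed.

(** By torsion some [y ^+ n] has the degree of a nonzero element of [K] and differs from it by a
    degree-0 factor, also in [K]; and a valuation ring contains [y] as soon as it contains
    [y ^+ n]. *)
Lemma torsion_injective (K O1 O2 : L -> Prop) : graded_subfield hom K ->
  (forall x, hom 0 x -> K x) ->
  (forall g x, hom g x -> x != 0 ->
    exists n : nat, (0 < n)%N /\ exists y, [/\ K y, y != 0 & hom (g *+ n) y]) ->
  val_ring hom O1 -> val_ring hom O2 -> lseteq (psi K O1) (psi K O2) -> lseteq O1 O2.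
Proof.
move=> [gK _] K0 tors hO1 hO2 e; have g1 := proj1 hO1; have g2 := proj1 hO2.
have power y : homogeneous hom y -> y != 0 -> exists2 n, (0 < n)%N & K (y ^+ n).
  move=> [g hy] y0; have [n [n0 [z [Kz z0 hz]]]] := tors g y hy y0; exists n => //.
  have uz : z \is a GRing.unit by apply: (homog_unit hL) => //; exists (g *+ n).
  rewrite -(divrK uz (y ^+ n)); apply: (gsubM gK) => //; apply: K0.
  by have := homM hL (homX hL n hy) (homV hL hz); rewrite subrr.
split; [apply: (gsub_le hL g1 g2)|apply: (gsub_le hL g2 g1)] => y hy y0 Oy;
    have [n n0 Ky] := power y hy y0.
  apply: (val_ring_expn hL hO2 hy n0); apply: (proj1 (proj1 (e _) _)); split=> //.
  exact: (gsubX g1).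
apply: (val_ring_expn hL hO1 hy n0); apply: (proj1 (proj2 (e _) _)); split=> //.
exact: (gsubX g2).
Qed.
End Bijectivity.

Theorem theorem7p4 (G : zmodType) (L : comUnitRingType) (hom : G -> L -> Prop)
  (l K k : L -> Prop)
  (hL : is_graded_field hom)
  (hl : graded_subfield hom l) (hK : graded_subfield hom K)
  (hk : graded_subfield hom k)
  (hkl : lsubset k l) (hkK : lsubset k K) :
  (* (1) surjectivity <-> general position *)
  ((forall O', graded_val_ring hom K k O' ->
      exists O, graded_val_ring hom (fun _ => True) l O /\ lseteq (psi K O) O')
   <-> general_position hom k l K)
  /\
  (* (2a) finite fibers if L/K finite *)
  (finite_ext hom K ->
    forall O', graded_val_ring hom K k O' ->
      exists (n : nat) (F : 'I_n -> (L -> Prop)),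
        forall O, graded_val_ring hom (fun _ => True) l O ->
          lseteq (psi K O) O' -> exists i, lseteq O (F i))
  /\
  (* (2b) injective if L = K *)
  ((forall x, K x) ->
    forall O1 O2, graded_val_ring hom (fun _ => True) l O1 ->
      graded_val_ring hom (fun _ => True) l O2 ->
      lseteq (psi K O1) (psi K O2) -> lseteq O1 O2)
  /\
  (* (3) bijective if l/k algebraic, L_1 = K_1, rho(L^x)/rho(K^x) torsion *)
  (algebraic_ext k l ->
   (forall x, hom 0 x -> K x) ->
   (forall g x, hom g x -> x != 0 ->
      exists n : nat, (0 < n)%N /\ exists y, [/\ K y, y != 0 & hom (g *+ n) y]) ->
   (forall O1 O2, graded_val_ring hom (fun _ => True) l O1 ->
      graded_val_ring hom (fun _ => True) l O2 ->
      lseteq (psi K O1) (psi K O2) -> lseteq O1 O2)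
   /\ (forall O', graded_val_ring hom K k O' ->
      exists O, graded_val_ring hom (fun _ => True) l O /\ lseteq (psi K O) O')).
Proof.
have [gl _] := hl; have [gk _] := hk.
have surj_gp : general_position hom k l K -> forall O', graded_val_ring hom K k O' ->
    exists O, graded_val_ring hom (fun _ => True) l O /\ lseteq (psi K O) O'.
  move=> gp O' hO'.
  have [O [hO lO e]] := general_position_extension hL hl hK hk hkK gp hO'.
  by exists O; split=> //; apply/graded_val_ring_full.
split; [split=> [surj|]; last exact: surj_gp|split; [|split]].
- apply: (surjective_general_position hL hl hK hk hkl hkK) => O' /surj[O [+ e]].
  by move=> /graded_val_ring_full[hO lO]; exists O.
- move=> fK O' hO'; have [n [F HF]] := finite_fibers hL hK fK hO'.
  by exists n, F => O /graded_val_ring_full[hO _] e; apply: HF.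
- by move=> KT O1 O2 _ _ e x; split=> Ox; [apply: (proj1 (proj1 (e x) _))|
    apply: (proj1 (proj2 (e x) _))]; split.
move=> alg K0 tors; split.
  move=> O1 O2 /graded_val_ring_full[hO1 _] /graded_val_ring_full[hO2 _].
  exact: (torsion_injective hL hK).
by apply: surj_gp; apply: algebraic_general_position.
Qed.
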